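(* Let $p\ge2$ be a constant and $0<\alpha,\varepsilon<1$. In the distributed tracking model with $k$ sites, universe $[n]$ and total stream length $m=\mathrm{poly}(n)$, there is a randomized tracking protocol (the paper's weak-cover tracking algorithm) that maintains at the coordinator a set $Q(t)$ of (index, value) pairs such that, for every time $t\in[m]$, with probability at least $\frac{7}{10}$, $Q(t)$ is a weak $(\alpha,\varepsilon)$-cover w.r.t. $u=v(t)^p$. Its total communication cost is $O\!\left(\left(\frac{k^{p-1}}{\alpha}+\frac{k}{\varepsilon^2}\right)\mathrm{polylog}(n)\right)$ bits.
   Context: Distributed tracking model: each site $i\in[k]$ receives over time a stream of items from $[n]$ (insertions only); $v_{ij}(t)$ is the count of $j$ at site $i$ up to time $t$ and $v_j(t)=\sum_i v_{ij}(t)$; $v(t)^p=(v_1(t)^p,\dots,v_n(t)^p)$. Communication cost is total bits exchanged over the whole stream. For a non-negative vector $u$ with $|u|=\sum_i u_i$, a non-empty set $Q=\{(i_1,w_1),\dots,(i_t,w_t)\}$ is a weak $(\alpha,\varepsilon)$-cover w.r.t. $u$ if (i) every $i\in[n]$ with $u_i>\alpha|u|$ appears as an index in $Q$, and (ii) $\big|\sum_{(j,w)\in Q}(w-u_j)\big|\le\varepsilon|u|$. *)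

(* Defs.v *)
From HB Require Import structures.
From mathcomp Require Import all_boot all_order all_algebra finmap.
From mathcomp Require Import boolp reals exp.

Set Implicit Arguments.
Unset Strict Implicit.
Unset Printing Implicit Defensive.

Import Order.TTheory GRing.Theory Num.Theory.

Local Open Scope ring_scope.

Definition bits := seq bool.

Record fdist (R : realType) (T : finType) := FDist {
  pmf :> T -> R;
  pmf_ge0 : forall x, 0 <= pmf x;
  pmf_sum1 : \sum_x pmf x = 1
}.

(* Protocols on a star network: the coordinator has a private two-way channel
   to each of the k sites. The only randomness is the private seed that every
   party holds from the start. Parties have no common clock: a site acts only
   when an item arrives at it or when the coordinator writes to it, and the
   coordinator acts only when a site writes to it. Local computation is free. *)
Record protocol (R : realType) (k n : nat) := Protocol {
  site_seed : finType;
  coord_seed : finType;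
  site_law : 'I_k -> fdist R site_seed;
  coord_law : fdist R coord_seed;
  site_state : Type;
  coord_state : Type;
  site_init : 'I_k -> site_seed -> site_state;
  coord_init : coord_seed -> coord_state;
  site_item : site_state -> 'I_n -> site_state * seq bits;
  site_recv : site_state -> bits -> site_state * seq bits;
  coord_recv : coord_state -> 'I_k -> bits -> coord_state * seq ('I_k * bits);
  coord_out : coord_state -> {fset 'I_n * R}
}.

Inductive message (k : nat) :=
| ToCoord of 'I_k & bits
| ToSite of 'I_k & bits.

Definition arrival (k n : nat) := ('I_k * 'I_n)%type.

Section Execution.
Variables (R : realType) (k n : nat) (P : protocol R k n).

(* [cost] accumulates the bits delivered so far, in both directions. *)
Record config := Config {
  sites : 'I_k -> site_state P;
  coord : coord_state P;
  pending : seq (message k);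
  cost : nat
}.

Definition seeds : finType :=
  ({ffun 'I_k -> site_seed P} * coord_seed P)%type.

Definition init (s : seeds) : config :=
  Config (fun i => site_init i (s.1 i)) (coord_init s.2) [::] 0%N.

(* One extra bit per message pays for its delimiter; in particular an empty
   message is not free. *)
Definition bit_cost (w : bits) : nat := (size w).+1.

Definition deliver (c : config) : config :=
  match pending c with
  | [::] => c
  | ToCoord i w :: q =>
      let: (s, out) := coord_recv (coord c) i w in
      Config (sites c) s (q ++ [seq ToSite o.1 o.2 | o <- out])
             (cost c + bit_cost w)%N
  | ToSite i w :: q =>
      let: (s, out) := site_recv (sites c i) w in
      Config [eta sites c with i |-> s] (coord c)
             (q ++ [seq ToCoord i w' | w' <- out]) (cost c + bit_cost w)%N
  end.

Definition arrive (c : config) (e : arrival k n) : config :=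
  let: (s, out) := site_item (sites c e.1) e.2 in
  Config [eta sites c with e.1 |-> s] (coord c)
         (pending c ++ [seq ToCoord e.1 w | w <- out]) (cost c).

(* Communication is instantaneous: all messages caused by an arrival are
   delivered before the next arrival. *)
Definition time_step (c : config) (e : arrival k n) (c' : config) : Prop :=
  exists N : nat, c' = iter N deliver (arrive c e) /\ pending c' = [::].

Fixpoint runs (c : config) (st : seq (arrival k n)) (c' : config) : Prop :=
  if st is e :: st' then exists2 c1, time_step c e c1 & runs c1 st' c'
  else c' = c.

Definition seeds_pmf (s : seeds) : R :=
  (\prod_(i < k) site_law P i (s.1 i)) * coord_law P s.2.

Definition Pr (E : seeds -> Prop) : R := \sum_(s | `[< E s >]) seeds_pmf s.

End Execution.

Definition site_count (k n : nat) (st : seq (arrival k n)) (t : nat)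
    (i : 'I_k) (j : 'I_n) : nat :=
  count_mem (i, j) (take t st).

Definition item_count (k n : nat) (st : seq (arrival k n)) (t : nat)
    (j : 'I_n) : nat :=
  (\sum_(i < k) site_count st t i j)%N.

Definition power_vector (R : realType) (k n : nat) (p : R)
    (st : seq (arrival k n)) (t : nat) (j : 'I_n) : R :=
  (item_count st t j)%:R `^ p.

Definition weak_cover (R : realType) (n : nat) (alpha eps : R)
    (u : 'I_n -> R) (Q : {fset 'I_n * R}) : Prop :=
  [/\ Q != fset0%fset,
      forall i, alpha * (\sum_j u j) < u i -> exists w, (i, w) \in Q
    & `|\sum_(q <- Q) (q.2 - u q.1)| <= eps * (\sum_j u j)].

(* The stream is fixed before the seeds are drawn, and the probability bound
   is for each time separately. *)
Definition tracks_weak_cover (R : realType) (k n : nat) (P : protocol R k n)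
    (p alpha eps : R) (m : nat) : Prop :=
  forall (st : m.-tuple (arrival k n)) (t : nat), (1 <= t <= m)%N ->
    7%:R / 10%:R <=
    Pr (fun s : seeds P => exists2 c : config P,
          runs (init s) (take t st) c &
          weak_cover alpha eps (power_vector p st t) (coord_out (coord c))).

(* Worst case over streams and seeds; termination of every run is included. *)
Definition total_cost_le (R : realType) (k n : nat) (P : protocol R k n)
    (m : nat) (B : R) : Prop :=
  forall (st : m.-tuple (arrival k n)) (s : seeds P),
    exists2 c : config P, runs (init s) st c & (cost c)%:R <= B.

(* Main.v *)
Require Import Defs.
From HB Require Import structures.
From mathcomp Require Import all_boot all_order all_algebra finmap.
From mathcomp Require Import boolp reals sequences exp.
From mathcomp Require Import zify ring lra.

(** Write [v_ij] for the count of item [j] at site [i], [v_j] for its total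
    count and [F] for the sum of the [v_j ^ p]. One copy of the protocol runs for
    each guess [G = (2 ^ g) ^ p] of [F]; a copy is stopped when its
    communication exceeds a fixed budget, and the coordinator answers from the
    smallest surviving guess.

    Discovery: at level [l], an arrival of [j] at a site that already holds about
    [2 ^ l / (2 k)] copies of [j] is reported with probability about
    [L / 2 ^ l], [L] logarithmic. Since [v_j >= 2 ^ l] forces half of the [v_j]
    arrivals to be of this kind, [r >= p] reports then occur with high
    probability, while they occur with probability at most [(L v_j / 2 ^ l) ^ p]
    in general. For the levels with [alpha G <= (4 * 2 ^ l) ^ p], and as long as
    [F <= G], this bounds the expected number of reports by [k ^ (p - 1) / alpha]
    and that of active items by [1 / alpha], up to logarithms.

    Estimation: once [j] is active, all sites are polled for [v_j], and from then
    on each arrival of [j] is sampled with probability [q] about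
    [(2 ^ l) ^ (p - 1) / (eps ^ 2 G)], where [l] is the highest active level of
    [j]; a sampled arrival triggers a poll and adds [(v_j ^ p - (v_j - 1) ^ p) / q]
    to the estimate. The total error is a martingale of variance
    [O(eps ^ 2 G F)], and the expected number of samples is [1 / eps ^ 2] up to
    logarithms.

    If [G <= 2 ^ p F] the heavy items are active and the error is small; if also
    [F <= G] the budget suffices by Markov's inequality. *)

Import Order.TTheory GRing.Theory Num.Theory.

Local Open Scope ring_scope.

Set Implicit Arguments.
Unset Strict Implicit.
Unset Printing Implicit Defensive.

(** * Independent coins *)

Section Coins.
Variables (R : realType) (I J : finType) (rate : J -> R).
Hypothesis rate01 : forall y, 0 <= rate y <= 1.

Definition bernoulli (q : R) (b : bool) : R := if b then q else 1 - q.

Definition coin_row_weight (w : {ffun J -> bool}) : R :=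
  \prod_y bernoulli (rate y) (w y).

Lemma coin_row_weight_ge0 w : 0 <= coin_row_weight w.
Proof.
apply: prodr_ge0 => y _; rewrite /bernoulli.
have /andP[? ?] := rate01 y; case: (w y); lra.
Qed.

Lemma sum_coin_row_weight : \sum_w coin_row_weight w = 1.
Proof.
rewrite -(bigA_distr_bigA (fun y b => bernoulli (rate y) b)) big1 // => y _.
by rewrite (bigD1 true) //= (bigD1 false) //= big_pred0 /bernoulli; [ring|case].
Qed.

Definition coin_row_law : fdist R {ffun J -> bool} :=
  FDist coin_row_weight_ge0 sum_coin_row_weight.

Definition coins := {ffun I -> {ffun J -> bool}}.

Definition coins_weight (w : coins) : R := \prod_i coin_row_weight (w i).

Definition expect (h : coins -> R) : R := \sum_w coins_weight w * h w.

Lemma coins_weight_ge0 w : 0 <= coins_weight w.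
Proof. by apply: prodr_ge0 => i _; exact: coin_row_weight_ge0. Qed.

Lemma sum_coins_weight : \sum_w coins_weight w = 1.
Proof.
rewrite -(bigA_distr_bigA (fun _ r => coin_row_weight r)) big1 // => i _.
exact: sum_coin_row_weight.
Qed.

Lemma expect_cst c : expect (fun=> c) = c.
Proof. by rewrite /expect -mulr_suml sum_coins_weight mul1r. Qed.

Lemma expectD h1 h2 : expect (fun w => h1 w + h2 w) = expect h1 + expect h2.
Proof. by rewrite /expect -big_split; apply: eq_bigr => w _; rewrite mulrDr. Qed.

Lemma expectZ c h : expect (fun w => c * h w) = c * expect h.
Proof. by rewrite /expect mulr_sumr; apply: eq_bigr => w _; rewrite mulrCA. Qed.

Lemma expect_sum (T : Type) (s : seq T) (P : pred T) (h : T -> coins -> R) :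
  expect (fun w => \sum_(x <- s | P x) h x w) = \sum_(x <- s | P x) expect (h x).
Proof.
rewrite /expect exchange_big /=; apply: eq_bigr => w _.
by rewrite mulr_sumr.
Qed.

Lemma eq_expect h1 h2 : h1 =1 h2 -> expect h1 = expect h2.
Proof. by move=> e; apply: eq_bigr => w _; rewrite e. Qed.

Lemma le_expect h1 h2 : (forall w, h1 w <= h2 w) -> expect h1 <= expect h2.
Proof.
move=> le; apply: ler_sum => w _; apply: ler_wpM2l => //.
exact: coins_weight_ge0.
Qed.

Lemma expect_ge0 h : (forall w, 0 <= h w) -> 0 <= expect h.
Proof. by move=> h0; rewrite -[leLHS](expect_cst 0); apply: le_expect. Qed.

Definition set_coin (w : coins) i y b : coins :=
  [ffun i' => [ffun y' => if (i' == i) && (y' == y) then b else w i' y']].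

(** Independence of one coin is expressed as invariance under overwriting it; this form can be
    checked along the recursion that builds a log. *)
Definition free_of_coin (T : Type) (h : coins -> T) i y :=
  forall w b, h (set_coin w i y b) = h w.

Lemma set_coinE w i y b : set_coin w i y b i y = b.
Proof. by rewrite !ffunE !eqxx. Qed.

(** Flipping the coin [(i, y)] is an involution on outcomes that fixes [h] and the weight of all
    other coins. Pairing each outcome with its flip leaves both values of [g], weighted by their
    probabilities. *)
Lemma expect_indep h i y (g : bool -> R) : free_of_coin h i y ->
  expect (fun w => h w * g (w i y)) =
  (rate y * g true + (1 - rate y) * g false) * expect h.
Proof.
move=> hfree.
pose flip (w : coins) := set_coin w i y (~~ w i y).
have flipK : involutive flip.
  move=> w; apply/ffunP => i'; apply/ffunP => y'; rewrite !ffunE !eqxx /=.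
  have [->|//] := eqVneq i' i; have [->|//] := eqVneq y' y.
  by rewrite /= negbK.
pose rest (w : coins) := (\prod_(y' | y' != y) bernoulli (rate y') (w i y')) *
  \prod_(i' | i' != i) coin_row_weight (w i').
have weightE w : coins_weight w = bernoulli (rate y) (w i y) * rest w.
  by rewrite /coins_weight (bigD1 i) //= /coin_row_weight (bigD1 y) //= -mulrA.
have rest_flip w : rest (flip w) = rest w.
  congr (_ * _).
    by apply: eq_bigr => y' /negPf ny; rewrite !ffunE eqxx ny.
  apply: eq_bigr => i' /negPf ni; apply: eq_bigr => y' _.
  by rewrite !ffunE ni.
(* The factor on the right does not involve [g']; the constant [g' = 1] in [e1] identifies it as
   [2 * expect h]. *)
have key (g' : bool -> R) : 2 * expect (fun w => h w * g' (w i y)) =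
    (rate y * g' true + (1 - rate y) * g' false) * \sum_w rest w * h w.
  rewrite /expect mulrDl mul1r {1}(reindex_inj (inv_inj flipK)) -big_split.
  rewrite mulr_sumr; apply: eq_bigr => w _ /=.
  rewrite !weightE rest_flip hfree set_coinE /bernoulli.
  by case: (w i y) => /=; ring.
have e1 : 2 * expect h = \sum_w rest w * h w.
  have := key (fun=> 1); rewrite (@eq_expect _ h) => [->|w]; last by rewrite mulr1.
  by rewrite !mulr1 addrC subrK mul1r.
apply: (@mulfI _ 2); first by rewrite pnatr_eq0.
by rewrite key -e1; ring.
Qed.

Lemma expect_mul_coin h i y : free_of_coin h i y ->
  expect (fun w => h w * (w i y)%:R) = rate y * expect h.
Proof.
move=> hf; rewrite (expect_indep (fun b => b%:R) hf) /=.
by congr (_ * _); ring.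
Qed.

Definition prob (E : coins -> Prop) : R := expect (fun w => (`[< E w >])%:R).

Lemma probE E : prob E = \sum_w coins_weight w * (`[< E w >])%:R.
Proof. by []. Qed.

Lemma markov (E : coins -> Prop) h c : 0 < c -> (forall w, 0 <= h w) ->
  (forall w, E w -> c <= h w) -> prob E <= expect h / c.
Proof.
move=> c0 h0 Eh; rewrite ler_pdivlMr // mulrC -expectZ.
apply: le_expect => w; case: asboolP => [/Eh|_]; first by rewrite mulr1.
by rewrite mulr0.
Qed.

Lemma prob_le E1 E2 : (forall w, E1 w -> E2 w) -> prob E1 <= prob E2.
Proof.
move=> s; apply: le_expect => w.
rewrite ler_nat; case: asboolP => [/s e2|_]; last exact: leq0n.
by rewrite asboolT.
Qed.

Lemma prob_or E1 E2 : prob (fun w => E1 w \/ E2 w) <= prob E1 + prob E2.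
Proof.
rewrite -expectD; apply: le_expect => w.
case: asboolP => [[e|e]|_]; rewrite ?(asboolT e) -?natrD ler_nat //.
by rewrite addnC.
Qed.

Lemma prob_exists (T : finType) (E : T -> coins -> Prop) :
  prob (fun w => exists x, E x w) <= \sum_x prob (E x).
Proof.
rewrite -expect_sum; apply: le_expect => w.
case: asboolP => [[x e]|_]; last by apply: sumr_ge0.
rewrite (bigD1 x) //= (asboolT e) lerDl; exact: sumr_ge0.
Qed.

Lemma probC E : prob E = 1 - prob (fun w => ~ E w).
Proof.
apply/eqP; rewrite eq_sym subr_eq -expectD -[eqbLHS](expect_cst 1).
apply/eqP/eq_expect => w.
by case: asboolP => e; [rewrite asboolF ?addr0 | rewrite asboolT ?add0r]; auto.
Qed.

End Coins.

(** * The log of one copy *)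

(** All code words have the same length, so the communication cost is determined by the number of
    messages. *)
Lemma exists_code (T : finType) (w : nat) : (#|T| <= 2 ^ w)%N ->
  exists (enc : T -> bits) (dec : bits -> option T),
    pcancel enc dec /\ forall x, size (enc x) = w.
Proof.
move=> le; have cardE : #|{: w.-tuple bool}| = (2 ^ w)%N.
  by rewrite card_tuple card_bool.
have lt (x : T) : (enum_rank x < #|{: w.-tuple bool}|)%N.
  by rewrite cardE (leq_trans (ltn_ord _)).
pose enc x : bits := enum_val (Ordinal (lt x)).
exists enc, (fun b => [pick x | enc x == b]); split=> [x|x]; last first.
  exact: size_tuple.
case: pickP => [y /eqP eqy|/(_ x)]; last by rewrite eqxx.
congr Some; apply: enum_rank_inj; apply/val_inj.
by have /(congr1 val) := enum_val_inj (val_inj eqy).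
Qed.

Section Model.
Variables (k n m h : nat) (j0 : 'I_n).
Variables (ripe : 'I_h -> nat -> bool) (allowed : rel 'I_h) (thr : 'I_h -> nat).

(** [total_seen] is meaningful only for entries that cause a poll; [extend] puts 0 in the others,
    since the coordinator then does not learn the total. *)
Record entry := Entry {
  item : 'I_n;
  levels_hit : {set 'I_h};
  sampled : bool;
  total_seen : nat
}.

Definition hits (lg : seq entry) l j : nat :=
  count (fun e => (item e == j) && (l \in levels_hit e)) lg.

(** The pair of level [g] and item [j0] is active from the start, where allowed, so that the answer
    is a non-empty set. This is exact at first, the count of [j0] being 0. *)
Definition active g lg l j : bool :=
  allowed g l && ((j == j0) && (l == g) || (thr l <= hits lg l j)%N).

Definition tracked g lg j : bool := [exists l, active g lg l j].

Definition top g lg j : option 'I_h :=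
  [pick l | active g lg l j && [forall l', active g lg l' j ==> (l' <= l)%N]].

Definition polled g lg e : bool :=
  sampled e ||
  [exists l, ~~ active g lg l (item e) && active g (e :: lg) l (item e)].

Definition reports (lg : seq entry) : nat :=
  sumn [seq #|levels_hit e| + k * sampled e | e <- lg].

Definition active_pairs g lg : {set 'I_h * 'I_n} :=
  [set x | active g lg x.1 x.2].

(** A potential for the communication of a copy: 1 per hit, and [k] per sample and per active pair,
    because samples and new active pairs cause polls. *)
Definition volume g lg : nat :=
  reports lg + k * #|active_pairs g lg|.

Definition with_total e v := Entry (item e) (levels_hit e) (sampled e) v.

Definition extend g lg e : seq entry :=
  if (levels_hit e == set0) && ~~ sampled e then lg
  else (if polled g lg e then e else with_total e 0) :: lg.

Definition site_items (past : seq (arrival k n)) i : seq 'I_n :=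
  [seq e.2 | e <- past & e.1 == i].

(** The coordinates are the number of earlier items at the site, the guess, the level, and the kind
    of coin: [true] for discovery, [false] for sampling. *)
Definition coin_index := ('I_m.+1 * 'I_h * 'I_h * bool)%type.

(* Reading coins through the number of earlier items of the site makes distinct
   arrivals use distinct coins, although sites have no common clock. *)
Definition drawn_hits g (row : {ffun coin_index -> bool}) (js : seq 'I_n) j : {set 'I_h} :=
  [set l | [&& allowed g l, ripe l (count_mem j js).+1
             & row (inord (size js), g, l, true)]].

Definition drawn_sample g (row : {ffun coin_index -> bool}) (js : seq 'I_n) t : bool :=
  if t is Some l then row (inord (size js), g, l, false) else false.

Definition total (past : seq (arrival k n)) j : nat :=
  count (fun e => e.2 == j) past.

Section CopyLog.
Variables (live : seq entry -> bool) (w : coins 'I_k coin_index) (g : 'I_h).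

(* [past] lists the arrivals so far, latest first. *)
Fixpoint copy_log (past : seq (arrival k n)) : seq entry :=
  if past is e :: past' then
    let lg := copy_log past' in
    if live lg then
      extend g lg (Entry e.2 (drawn_hits g (w e.1) (site_items past' e.1) e.2)
        (drawn_sample g (w e.1) (site_items past' e.1) (top g lg e.2))
        (total past e.2))
    else lg
  else [::].

End CopyLog.

Lemma hits_extend g lg e l j : hits (extend g lg e) l j =
  ((item e == j) && (l \in levels_hit e) + hits lg l j)%N.
Proof.
rewrite /extend; case: ifP => [/andP[/eqP-> _]|_]; first by rewrite inE andbF.
by case: ifP.
Qed.

Lemma eq_active g lg1 lg2 : (forall l j, hits lg1 l j = hits lg2 l j) ->
  active g lg1 =2 active g lg2.
Proof. by move=> e l j; rewrite /active e. Qed.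

Lemma eq_top g lg1 lg2 j : (forall l, active g lg1 l j = active g lg2 l j) ->
  top g lg1 j = top g lg2 j.
Proof.
move=> e; rewrite /top; apply: eq_pick => l /=; rewrite e; congr (_ && _).
by apply: eq_forallb => l'; rewrite e.
Qed.

Lemma active_extend_sub g lg e l j :
  active g lg l j -> active g (extend g lg e) l j.
Proof.
rewrite /active => /andP[-> /orP[->//|le]]; rewrite hits_extend /=.
by rewrite (leq_trans le (leq_addl _ _)) orbT.
Qed.

Lemma active_extend_other g lg e l j : item e != j ->
  active g (extend g lg e) l j = active g lg l j.
Proof. by move=> /negPf ne; rewrite /active hits_extend ne. Qed.

Lemma active_cons g lg e l j : active g (e :: lg) l j = active g (extend g lg e) l j.
Proof. by rewrite /active hits_extend. Qed.

Lemma reports_extend g lg e :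
  reports (extend g lg e) = (#|levels_hit e| + k * sampled e + reports lg)%N.
Proof.
rewrite /extend; case: ifP => [/andP[/eqP-> /negPf->]|_].
  by rewrite cards0 muln0 !add0n.
by case: ifP.
Qed.

Lemma extend_unpolled g lg e v :
  ~~ polled g lg e -> extend g lg (with_total e v) = extend g lg e.
Proof.
move=> np; rewrite /extend (_ : polled g lg (with_total e v) = polled g lg e) //.
by rewrite (negPf np).
Qed.

Lemma active_pairs_extend g lg e :
  active_pairs g lg \subset active_pairs g (extend g lg e).
Proof. by apply/subsetP => x; rewrite !inE; exact: active_extend_sub. Qed.

Lemma volume_extend g lg e : (volume g lg <= volume g (extend g lg e))%N.
Proof.
rewrite /volume reports_extend leq_add ?leq_addl // leq_mul2l.
by rewrite subset_leq_card ?orbT // active_pairs_extend.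
Qed.

(** A poll has one of two causes: a sample, which adds [k] to [reports], or a newly active pair,
    which adds [k] through [active_pairs]. *)
Lemma volume_extend_polled g lg e : polled g lg e ->
  (volume g lg + k <= volume g (extend g lg e))%N.
Proof.
rewrite /volume reports_extend /polled => /orP[->|].
  have := leq_mul (leqnn k) (subset_leq_card (active_pairs_extend g lg e)).
  move: #|active_pairs g lg| #|_| #|_| => x y z; rewrite muln1; lia.
case/existsP => l /andP[na a].
have lt : (#|active_pairs g lg| < #|active_pairs g (extend g lg e)|)%N.
  apply: proper_card; apply/properP; split; first exact: active_pairs_extend.
  by exists (l, item e); rewrite inE //= -active_cons.
have := leq_mul (leqnn k) lt; rewrite mulnS; lia.
Qed.

Lemma volume_extend_event g lg e :
  ~~ ((levels_hit e == set0) && ~~ sampled e) -> (0 < k)%N ->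
  (volume g lg < volume g (extend g lg e))%N.
Proof.
rewrite negb_and negbK -card_gt0 => ev k0; case: (boolP (sampled e)) ev => [s _|s].
  have : polled g lg e by rewrite /polled s.
  by move/volume_extend_polled; lia.
rewrite orbF => c0; rewrite /volume reports_extend.
have := leq_mul (leqnn k) (subset_leq_card (active_pairs_extend g lg e)); lia.
Qed.

(** One arrival brings at most [h] hits, one sample, and [h] new active levels of its own item. This
    bounds how far a copy can overshoot its budget. *)
Lemma volume_extend_le g lg e :
  (volume g (extend g lg e) <= volume g lg + (h + k + k * h))%N.
Proof.
rewrite /volume reports_extend.
have hH : (#|levels_hit e| <= h)%N by rewrite -[leqRHS]card_ord max_card.
have kS : (k * sampled e <= k)%N by rewrite -[leqRHS]muln1 leq_mul // leq_b1.
have : (#|active_pairs g (extend g lg e)| <= #|active_pairs g lg| + h)%N.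
  apply: (@leq_trans #|active_pairs g lg :|: [set (l, item e) | l in 'I_h]|).
    apply/subset_leq_card/subsetP => -[l j]; rewrite !inE /=.
    have [<- _|ne] := eqVneq (item e) j; first by rewrite imset_f ?orbT.
    by rewrite active_extend_other // => ->.
  rewrite cardsU; apply: leq_trans (leq_subr _ _) _; rewrite leq_add2l.
  by rewrite -[leqRHS]card_ord leq_imset_card.
move=> /(leq_mul (leqnn k)); rewrite mulnDr; lia.
Qed.

End Model.

(** * The protocol *)

Section Delivery.
Variables (R : realType) (k n : nat) (P : protocol R k n).

(** The queue is first in, first out: the replies gather behind the copies of [d] that are still to
    be delivered. *)
Lemma deliver_broadcast (ids : seq 'I_k) d (rep : 'I_k -> bits)
    (si si' : 'I_k -> site_state P) co rest cst :
  uniq ids ->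
  (forall i, i \in ids -> site_recv (si i) d = (si' i, [:: rep i])) ->
  iter (size ids) (@deliver R k n P)
    (Config si co ([seq ToSite i d | i <- ids] ++ rest) cst) =
  Config (fun i => if i \in ids then si' i else si i) co
    (rest ++ [seq ToCoord i (rep i) | i <- ids])
    (cst + size ids * bit_cost d)%N.
Proof.
elim: ids si rest cst => [|i ids IH] si rest cst.
  by rewrite /= cats0 mul0n addn0.
case/andP=> ni u sr; rewrite [size _]/= iterSr.
rewrite [deliver _]/deliver /= sr ?mem_head //= -catA.
rewrite (IH _ _ _ u) => [|i' i'ids] /=; last first.
  have /negPf-> : i' != i by apply: contraNneq ni => <-.
  by rewrite sr // inE i'ids orbT.
rewrite -catA mulSn addnA; congr Config; apply/funext => i'.
rewrite inE; have [->|//] := eqVneq i' i.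
by rewrite (negPf ni).
Qed.

Lemma deliver_replies (T : Type) (ids : seq T) (snd : T -> 'I_k) (b : T -> bits)
    (si : 'I_k -> site_state P) co cst wd (stp : coord_state P -> T -> coord_state P) :
  (forall c i, coord_recv c (snd i) (b i) = (stp c i, [::])) ->
  (forall i, bit_cost (b i) = wd) ->
  iter (size ids) (@deliver R k n P)
    (Config si co [seq ToCoord (snd i) (b i) | i <- ids] cst) =
  Config si (foldl stp co ids) [::] (cst + size ids * wd)%N.
Proof.
move=> cr bw; elim: ids co cst => [|i ids IH] co cst.
  by rewrite /= mul0n addn0.
rewrite [size _]/= iterSr [deliver _]/deliver /= cr /= cats0 IH.
by rewrite mulSn addnA bw.
Qed.

End Delivery.

Lemma sum_site_counts (k n : nat) (past : seq (arrival k n)) j :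
  (\sum_i count_mem j (site_items past i))%N = total past j.
Proof.
under eq_bigr do rewrite count_map count_filter.
elim: past => [|e past IH] /=; first by rewrite big1.
rewrite big_split /= IH; congr (_ + _)%N; rewrite (bigD1 e.1) //= eqxx andbT.
by rewrite big1 ?addn0 // => i /negPf ni; rewrite [e.1 == i]eq_sym ni andbF.
Qed.

Section Protocol.
Variables (R : realType) (k n m h : nat) (j0 : 'I_n).
Variables (ripe : 'I_h -> nat -> bool) (allowed : rel 'I_h) (thr : 'I_h -> nat).
Variables (B : nat) (pw : nat -> R) (val_rate : 'I_h -> 'I_h -> R).

Local Notation entry := (entry n h).
Local Notation active := (active j0 allowed thr).
Local Notation top := (top j0 allowed thr).
Local Notation tracked := (tracked j0 allowed thr).
Local Notation polled := (polled j0 allowed thr).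
Local Notation extend := (extend j0 allowed thr).
Local Notation volume := (volume k j0 allowed thr).
Local Notation drawn_hits := (@drawn_hits n m h ripe allowed).

Definition live g (lg : seq entry) : bool := (volume g lg <= B)%N.

Local Notation clog w g := (copy_log (m := m) j0 ripe allowed thr (live g) w g).

(* Exact when [j] becomes tracked; the inverse weights then make it unbiased. *)
Fixpoint estimate g (lg : seq entry) j : R :=
  if lg is e :: lg' then
    if item e == j then
      if top g lg' j is Some l then
        estimate g lg' j + (if sampled e then
          (pw (total_seen e) - pw (total_seen e).-1) / val_rate g l else 0)
      else if tracked g lg j then pw (total_seen e) else 0
    else estimate g lg' j
  else 0.

(** One message serves all guesses at once. A report carries the levels hit for each guess and the
    set of guesses that sample; an update carries the top level for each guess and the set of live
    guesses. *)
Definition msg :=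
  ('I_n * {ffun 'I_h -> {set 'I_h}} * {set 'I_h}
   + 'I_n * {ffun 'I_h -> option 'I_h} * {set 'I_h} + 'I_m.+1)%type.

Definition Report j H S : msg := inl (inl (j, H, S)).
Definition Update j T A : msg := inl (inr (j, T, A)).
Definition Count x : msg := inr x.

Variables (wd : nat) (enc : msg -> bits) (dec : bits -> option msg).
Hypothesis encK : pcancel enc dec.
Hypothesis size_enc : forall x, size (enc x) = wd.

Record site_memory := SiteMemory {
  row : {ffun coin_index m h -> bool};
  items : seq 'I_n;
  tops : 'I_n -> {ffun 'I_h -> option 'I_h};
  lives : {set 'I_h}
}.

Definition site_hits s j : {ffun 'I_h -> {set 'I_h}} :=
  [ffun g => if g \in lives s then drawn_hits g (row s) (items s) j else set0].

Definition site_samples s j : {set 'I_h} :=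
  [set g | (g \in lives s) && drawn_sample g (row s) (items s) (tops s j g)].

Definition on_item s j : site_memory * seq bits :=
  let H := site_hits s j in let S := site_samples s j in
  (SiteMemory (row s) (j :: items s) (tops s) (lives s),
   if (H == [ffun=> set0]) && (S == set0) then [::] else [:: enc (Report j H S)]).

Definition on_update s (b : bits) : site_memory * seq bits :=
  if dec b is Some (inl (inr (j, T, A))) then
    (SiteMemory (row s) (items s) [eta tops s with j |-> T] A,
     [:: enc (Count (inord (count_mem j (items s))))])
  else (s, [::]).

(* [replies] accumulates the counts polled because of [batch], which is
   appended to [logs] only when the next report comes. *)
Record coord_memory := CoordMemory {
  logs : 'I_h -> seq entry;
  batch : 'I_n * {ffun 'I_h -> {set 'I_h}} * {set 'I_h};
  replies : nat
}.

Definition batch_entry (u : 'I_n * {ffun 'I_h -> {set 'I_h}} * {set 'I_h}) v g :=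
  Entry u.1.1 (u.1.2 g) (g \in u.2) v.

Definition current c g : seq entry :=
  extend g (logs c g) (batch_entry (batch c) (replies c) g).

(** What the sites know becomes outdated only if a top level changes, which requires a newly active
    level and hence a poll, or if a copy is stopped. *)
Definition must_update c : bool :=
  [exists g, polled g (logs c g) (batch_entry (batch c) 0 g)
             || live g (logs c g) && ~~ live g (current c g)].

Definition on_message c (i : 'I_k) (b : bits) :
    coord_memory * seq ('I_k * bits) :=
  match dec b with
  | Some (inl (inl u)) =>
      let c' := CoordMemory (current c) u 0 in
      (c', if must_update c' then
             [seq (i', enc (Update u.1.1 [ffun g => top g (current c' g) u.1.1]
                              [set g | live g (current c' g)])) | i' <- enum 'I_k]
           else [::])
  | Some (inr x) => (CoordMemory (logs c) (batch c) (replies c + x), [::])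
  | _ => (c, [::])
  end.

Definition first_live c : option 'I_h :=
  [pick g | live g (current c g)
            && [forall g', live g' (current c g') ==> (g <= g')%N]].

Definition output c : {fset 'I_n * R} :=
  if first_live c is Some g then
    [fset (j, estimate g (current c g) j)
       | j in [seq j <- enum 'I_n | tracked g (current c g) j]]%fset
  else [fset (j0, 0)]%fset.

(** * The protocol simulates the logs *)

Variables (rate : coin_index m h -> R).
Hypothesis rate01 : forall y, 0 <= rate y <= 1.

Lemma sum_unit_law : \sum_(x : unit) (1 : R) = 1.
Proof. by rewrite sumr_const card_unit. Qed.

Definition cover_protocol : protocol R k n :=
  Protocol
    (fun=> coin_row_law rate01)
    (FDist (fun _ : unit => ler01) sum_unit_law)
    (fun _ w => SiteMemory w [::] (fun j => [ffun g => top g [::] j])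
                  [set g | live g [::]])
    (fun=> CoordMemory (fun=> [::]) (j0, [ffun=> set0], set0) 0)
    on_item on_update on_message output.

Definition charge w (past : seq (arrival k n)) : nat :=
  (wd.+1 * (3 * (\sum_g volume g (clog w g past))
            + 2 * k * #|[set g | ~~ live g (clog w g past)]|))%N.

(** The invariant ties the network to the logs defined globally from arrivals and coins, so that the
    probabilistic analysis need not mention messages. *)
Definition simulates (w : coins 'I_k (coin_index m h)) past
    (c : config cover_protocol) : Prop :=
  [/\ pending c = [::],
    forall i, [/\ row (sites c i) = w i, items (sites c i) = site_items past i,
       forall j g, tops (sites c i) j g = top g (clog w g past) j
       & lives (sites c i) = [set g | live g (clog w g past)]],
    forall g, current (Defs.coord c) g = clog w g past
    & (cost c <= charge w past)%N].

Lemma init_simulates (s : seeds cover_protocol) :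
  simulates s.1 [::] (init s).
Proof.
split=> //= [i|g].
  by split=> // j g; rewrite ffunE.
by rewrite /current /extend /= ffunE inE eqxx.
Qed.

Lemma clog_cons (w : coins 'I_k (coin_index m h)) g past e : clog w g (e :: past) =
  if live g (clog w g past) then
    extend g (clog w g past)
      (Entry e.2 (drawn_hits g (w e.1) (site_items past e.1) e.2)
        (drawn_sample g (w e.1) (site_items past e.1) (top g (clog w g past) e.2))
        (total (e :: past) e.2))
  else clog w g past.
Proof. by []. Qed.

Lemma extend_nothing g lg e :
  levels_hit e = set0 -> sampled e = false -> extend g lg e = lg.
Proof. by rewrite /extend => -> ->; rewrite eqxx. Qed.

Lemma top_extend g lg e j : item e != j \/ ~~ polled g lg e ->
  top g (extend g lg e) j = top g lg j.
Proof.
move=> hyp; apply: eq_top => l.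
have [ej|] := eqVneq (item e) j; last exact: active_extend_other.
case: hyp => [/eqP //|]; rewrite /polled negb_or => /andP[_ /existsPn/(_ l)].
rewrite ej active_cons; case: (boolP (active _ _ _ _)) => [a _|_] /=; last by move/negPf.
by rewrite active_extend_sub.
Qed.

(** The site holds its coins, its items, the top levels and the live set, so its draws coincide with
    those of the log. *)
Lemma arrive_simulates w past c i j (s := sites c i) :
  simulates w past c -> forall g, clog w g ((i, j) :: past) =
  extend g (clog w g past)
    (batch_entry (j, site_hits s j, site_samples s j) (total ((i, j) :: past) j) g).
Proof.
move=> [_ st _ _] g; have [rw it tp lv] := st i.
rewrite clog_cons /= /batch_entry /= inE ffunE -/s lv inE.
case: ifP => lg /=; last by rewrite extend_nothing.
by rewrite rw it tp.
Qed.

Lemma step_simulates w past c e : (0 < k)%N -> (size past < m)%N ->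
  simulates w past c ->
  exists2 c', time_step c e c' & simulates w (e :: past) c'.
Proof.
case: e => i j k0 szm sim; have LE := arrive_simulates i j sim.
have [pc st cur cst] := sim; have [rw it tp lv] := st i.
set s := sites c i in LE rw it tp lv.
set H := site_hits s j in LE; set S := site_samples s j in LE.
pose sites1 i' := if i' == i then SiteMemory (row s) (j :: items s) (tops s) (lives s)
  else sites c i'.
have arrE : arrive c (i, j) =
    Config (P := cover_protocol) sites1 (Defs.coord c)
      (if (H == [ffun=> set0]) && (S == set0) then [::]
       else [:: ToCoord i (enc (Report j H S))]) (cost c).
  by rewrite /arrive /= pc /=; case: ifP.
have deadE g : ~~ live g (clog w g past) -> ~~ live g (clog w g ((i, j) :: past)).
  by rewrite clog_cons => /negPf ld; rewrite ld ld.
have itemsE i' : site_items ((i, j) :: past) i' =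
    if i' == i then j :: site_items past i else site_items past i'.
  by rewrite /site_items /= eq_sym; case: eqP => // ->.
have sites1E i' : [/\ row (sites1 i') = w i',
    items (sites1 i') = site_items ((i, j) :: past) i',
    forall j' g, tops (sites1 i') j' g = top g (clog w g past) j'
    & lives (sites1 i') = [set g | live g (clog w g past)]].
  rewrite /sites1 itemsE; have [->|_] := eqVneq i' i; last exact: st.
  by split; rewrite //= it.
(* First case: no guess has a hit or a sample. Nothing is sent, and no log changes. *)
case: (boolP ((H == _) && _)) arrE => [/andP[/eqP H0 /eqP S0]|ev] arrE.
  have same g : clog w g ((i, j) :: past) = clog w g past.
    by rewrite LE extend_nothing ?H0 ?S0 //= ?ffunE ?inE.
  eexists; first by exists 0%N; split; [reflexivity|by rewrite arrE].
  rewrite arrE; split=> [//|i'|g|].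
  - have [rw' it' tp' lv'] := sites1E i'.
    rewrite [sites _ _]/(sites1 i').
    split=> // [j' g|]; rewrite ?tp' ?same // lv'.
    by apply/setP => g; rewrite !inE same.
  - by rewrite same [LHS]cur.
  - rewrite [cost _]/= /charge; under eq_bigr do rewrite same.
    rewrite (_ : [set g | _] = [set g | ~~ live g (clog w g past)]) //.
    by apply/setP => g; rewrite !inE same.
pose L' g := clog w g ((i, j) :: past).
(* The coordinator after the report and before any reply: the pending entry still has total 0, but
   hits, top levels and volumes do not depend on totals, so the update it sends is already right. *)
pose co' := CoordMemory (current (Defs.coord c)) (j, H, S) 0.
pose tot := total ((i, j) :: past) j.
pose be g := batch_entry (j, H, S) tot g.
have LE' g : L' g = extend g (clog w g past) (be g) by exact: LE.
have co'E g : current co' g = extend g (clog w g past) (with_total (be g) 0).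
  by rewrite {1}/current /= cur.
have hitsE g l j' : hits (current co' g) l j' = hits (L' g) l j'.
  by rewrite co'E LE' !hits_extend.
have topE g j' : top g (current co' g) j' = top g (L' g) j'.
  by apply: eq_top => l; exact: eq_active.
have volE g : volume g (current co' g) = volume g (L' g).
  rewrite /volume; congr (_ + k * _)%N; first by rewrite co'E LE' !reports_extend.
  by apply: eq_card => x; rewrite !inE; exact: eq_active.
have liveE g : live g (current co' g) = live g (L' g) by rewrite /live volE.
have dead_sub : [set g | ~~ live g (clog w g past)] \subset [set g | ~~ live g (L' g)].
  by apply/subsetP => g; rewrite !inE; exact: deadE.
have dead_le := subset_leq_card dead_sub.
have [g0 ev0] : exists g, ~~ ((levels_hit (be g) == set0) && ~~ sampled (be g)).
  apply: contrapT => no; move/negP: ev; apply; apply/andP.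
  have no' g : H g = set0 /\ g \notin S.
    have /negP : ~ ~~ ((levels_hit (be g) == set0) && ~~ sampled (be g)).
      by move=> ?; apply: no; exists g.
    by rewrite negbK => /andP[/eqP ? ?].
  split; first by apply/eqP/ffunP => g; rewrite [RHS]ffunE; case: (no' g).
  by apply/eqP/setP => g; rewrite [RHS]inE; apply/negbTE; case: (no' g).
have vol_le g : (volume g (clog w g past) <= volume g (L' g))%N.
  by rewrite LE' volume_extend.
have vol_g0 : (volume g0 (clog w g0 past) < volume g0 (L' g0))%N.
  by rewrite LE' volume_extend_event.
pose V := (\sum_g volume g (clog w g past))%N.
pose V' := (\sum_g volume g (L' g))%N.
pose D := #|[set g | ~~ live g (clog w g past)]|.
pose D' := #|[set g | ~~ live g (L' g)]|.
have vol_raise d g : (volume g (clog w g past) + d <= volume g (L' g))%N -> (V + d <= V')%N.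
  move=> led; rewrite /V /V' (bigD1 g) //= [leqRHS](bigD1 g) //= addnAC.
  by rewrite leq_add // leq_sum.
have chargeE : charge w past = (wd.+1 * (3 * V + 2 * k * D))%N by [].
have chargeE' : charge w ((i, j) :: past) = (wd.+1 * (3 * V' + 2 * k * D'))%N by [].
have V1 : (V + 1 <= V')%N by apply: (vol_raise _ g0); rewrite addn1.
have deliver1 : deliver (arrive c (i, j)) = Config (P := cover_protocol) sites1 co'
    (if must_update co' then
       [seq ToSite i' (enc (Update j [ffun g => top g (current co' g) j]
                              [set g | live g (current co' g)])) | i' <- enum 'I_k]
     else [::]) (cost c + wd.+1)%N.
  rewrite arrE /deliver /= /on_message encK /= /bit_cost size_enc.
  by congr Config; case: ifP => // _; rewrite -map_comp.
(* Without an update, the total stays 0, as in the log, and the sites' knowledge remains valid. *)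
case: (boolP (must_update co')) deliver1 => [mu|nmu] deliver1; last first.
  move: nmu => /existsPn nmu.
  have npol g : ~~ polled g (clog w g past) (be g).
    by move: (nmu g); rewrite negb_or => /andP[+ _]; rewrite /= cur.
  have curE g : current co' g = L' g.
    by rewrite co'E LE' extend_unpolled.
  have live_same g : live g (L' g) = live g (clog w g past).
    have := nmu g; rewrite negb_or negb_and negbK curE => /andP[_]; rewrite /= cur.
    case: (boolP (live g (clog w g past))) => //= nl _.
    exact/negbTE/deadE.
  eexists; first by exists 1%N; split; [reflexivity|by rewrite [iter _ _ _]deliver1].
  rewrite [iter _ _ _]deliver1; split=> [//|i'|//|].
    rewrite [sites _ _]/(sites1 i'); have [rw' it' tp' lv'] := sites1E i'.
    split=> // [j' g|]; last by rewrite lv'; apply/setP => g; rewrite !inE live_same.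
    by rewrite tp' -/(L' g) LE' top_extend //; right.
  rewrite [cost _]/=; apply: leq_trans (leq_add cst (leqnn _)) _.
  rewrite chargeE chargeE' -[X in (_ + X)%N]muln1 -mulnDr leq_mul2l /=.
  have := leq_mul (leqnn (2 * k)) dead_le; rewrite -/D -/D'; lia.
pose si2 i' := SiteMemory (w i') (site_items ((i, j) :: past) i')
  [eta tops (sites1 i') with j |-> [ffun g => top g (current co' g) j]]
  [set g | live g (current co' g)].
pose rep i' := enc (Count (inord (count_mem j (site_items ((i, j) :: past) i')))).
pose upd := enc (Update j [ffun g => top g (current co' g) j]
                              [set g | live g (current co' g)]).
have deliver2 := @deliver_broadcast R k n cover_protocol (enum 'I_k) upd rep sites1 si2
  co' [::] (cost c + wd.+1) (enum_uniq _).
have recvE i' : site_recv (p := cover_protocol) (sites1 i') upd = (si2 i', [:: rep i']).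
  have [rw' it' tp' lv'] := sites1E i'.
  by rewrite /= /on_update encK /rep /si2 rw' it'.
have {}deliver2 := deliver2 (fun i' _ => recvE i').
pose cnt i' := count_mem j (site_items ((i, j) :: past) i').
have cnt_le i' : (cnt i' < m.+1)%N.
  rewrite ltnS (leq_trans (count_size _ _)) // size_map size_filter.
  by rewrite (leq_trans (count_size _ _)).
pose stp (co : coord_memory) i' := CoordMemory (logs co) (batch co) (replies co + cnt i').
have deliver3 := @deliver_replies R k n cover_protocol _ (enum 'I_k) id rep si2
  co' (cost c + wd.+1 + k * wd.+1) wd.+1 stp.
have stpE co i' : coord_recv (p := cover_protocol) co i' (rep i') = (stp co i', [::]).
  by rewrite /rep /= /on_message encK /= (inordK (cnt_le i')).
have bitE i' : bit_cost (rep i') = wd.+1 by rewrite /bit_cost size_enc.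
have {}deliver3 := deliver3 stpE bitE.
have foldE co : foldl stp co (enum 'I_k) =
    CoordMemory (logs co) (batch co) (replies co + \sum_(i' <- enum 'I_k) cnt i').
  elim: (enum 'I_k) co => [|i' ids IH] co; first by rewrite big_nil addn0; case: co.
  by rewrite /= IH big_cons /= addnA.
have totE : (\sum_(i' <- enum 'I_k) cnt i')%N = tot.
  by rewrite big_enum /tot -sum_site_counts.
pose cf := Config (P := cover_protocol) si2 (CoordMemory (logs co') (batch co') tot)
  [::] (cost c + wd.+1 + k * wd.+1 + k * wd.+1)%N.
(* One delivery for the report, [k] for the updates, [k] for the replies. *)
have final : iter (k + (k + 1)) (@deliver R k n cover_protocol) (arrive c (i, j)) = cf.
  rewrite size_enum_ord cats0 in deliver2; rewrite size_enum_ord in deliver3.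
  rewrite iterD iterD [iter 1 _ _]deliver1 deliver2.
  rewrite (_ : Config _ _ _ _ = Config (P := cover_protocol) si2 co'
    [seq ToCoord (id i') (rep i') | i' <- enum 'I_k] (cost c + wd.+1 + k * wd.+1)).
    by rewrite deliver3 foldE totE.
  rewrite /bit_cost size_enc; congr Config.
  by apply/funext => i'; rewrite mem_enum.
exists cf; first by exists (k + (k + 1))%N.
split=> [//|i'|g|].
- have [rw' it' tp' lv'] := sites1E i'.
  split=> // [j' g|]; last by apply/setP => g; rewrite !inE liveE.
  rewrite -[RHS]/(top g (L' g) j') [LHS]/=; case: eqP => [->|/eqP ne].
    by rewrite ffunE topE.
  by rewrite tp' LE' top_extend //; left; rewrite eq_sym.
- by rewrite -[RHS]/(L' g) LE' /cf /current /= cur.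
rewrite chargeE' [cost _]/=.
(* The [1 + 2 * k] messages are paid by [3 * k] if there was a poll, and otherwise by [3 + 2 * k],
   since a copy has just been stopped. *)
apply: (@leq_trans (charge w past + wd.+1 * (1 + 2 * k))); first by lia.
rewrite chargeE -mulnDr leq_mul2l /=.
case/existsP: mu => g /orP[pol|/andP[lg dg]].
  have : (V + k <= V')%N.
    apply: (vol_raise _ g); rewrite LE' volume_extend_polled //.
    by move: pol; rewrite /= cur.
  have := leq_mul (leqnn (2 * k)) dead_le; rewrite -/D -/D'; lia.
have lt : (D < D')%N.
  apply: proper_card; apply/properP; split=> //.
  by exists g; rewrite inE ?negbK -?liveE // -cur.
have := leq_mul (leqnn (2 * k)) lt; lia.
Qed.

Lemma run_simulates (s : seeds cover_protocol) (st : seq (arrival k n)) :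
  (0 < k)%N -> (size st <= m)%N ->
  exists2 c, runs (init s) st c & simulates s.1 (rev st) c.
Proof.
move=> k0 le; rewrite /rev.
suff gen past c : simulates s.1 past c -> (size past + size st <= m)%N ->
    exists2 c', runs c st c' & simulates s.1 (catrev st past) c'.
  by apply: gen => //; exact: init_simulates.
elim: st c past {le} => [|e st IH] c past sim le /=; first by exists c.
have lt : (size past < m)%N by apply: leq_trans le; rewrite /= addnS ltnS leq_addr.
have [c1 step sim1] := step_simulates e k0 lt sim.
have [|c2 run sim2] := IH c1 (e :: past) sim1; first by rewrite addSnnS.
by exists c2 => //; exists c1.
Qed.

End Protocol.

(** * Analysis of one copy *)

Section Powers.
Variables (R : realType) (p : R) (r : nat).
Hypotheses (p1 : 1 <= p) (pr : p <= r%:R).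

(** The growth of the moment at the arrival that raises a count to [v]. *)
Definition gain (v : nat) : R := v%:R `^ p - v.-1%:R `^ p.

(** Write [x ^ p] as [x * x ^ (p - 1)] and replace the factor [(v - 1) ^ (p - 1)] by
    [v ^ (p - 1)]. *)
Lemma gain_ge (v : nat) : (0 < v)%N -> v%:R `^ (p - 1) <= gain v.
Proof.
have p0 : 0 < p by exact: lt_le_trans ltr01 p1.
case: v => // v _; rewrite /gain /= -(mulr_powRB1 (ler0n R v) p0)
  -(mulr_powRB1 (ler0n R v.+1) p0).
have : v%:R `^ (p - 1) <= v.+1%:R `^ (p - 1) :> R.
  by apply: ge0_ler_powR; rewrite ?nnegrE ?ler0n ?ler_nat ?subr_ge0.
move/(ler_wpM2l (ler0n R v)); rewrite -[v.+1%:R in X in _ -> _ <= X * _ - _]natr1.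
move: (v%:R `^ _) (v.+1%:R `^ _) => a b; lra.
Qed.

Lemma bernoulli_ineq (x : R) (s : nat) : 0 <= x <= 1 -> 1 - s%:R * x <= (1 - x) ^+ s.
Proof.
case/andP=> x0 x1; elim: s => [|s IH]; first by rewrite expr0 mul0r subr0.
rewrite exprS; apply: le_trans (ler_wpM2l _ IH); last by rewrite subr_ge0.
rewrite -natr1; have : 0 <= s%:R * x * x by rewrite !mulr_ge0.
lra.
Qed.

(** With [x = 1 / v], [(1 - x) ^ p >= (1 - x) ^ r >= 1 - r * x] by Bernoulli's inequality. *)
Lemma gain_le (v : nat) : (0 < v)%N -> gain v <= r%:R * v%:R `^ (p - 1).
Proof.
have p0 : 0 < p by exact: lt_le_trans ltr01 p1.
move=> v0; have vR : 0 < v%:R :> R by rewrite ltr0n.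
rewrite /gain; set a := _ `^ (p - 1).
have v1 : v.-1%:R = v%:R * (1 - v%:R^-1) :> R.
  by rewrite -subn1 natrB // mulrBr mulr1 mulfV // gt_eqF.
have i01 : 0 <= (v%:R^-1 : R) <= 1 by rewrite invr_ge0 ler0n invf_le1 //= ler1n.
have /andP[i0 i1] := i01.
have : v%:R `^ p * (1 - v%:R^-1) ^+ r <= v.-1%:R `^ p.
  rewrite v1 powRM ?ler0n ?subr_ge0 // ler_wpM2l ?powR_ge0 //.
  have [->|ne] := eqVneq v%:R^-1 (1 : R).
    rewrite subrr powR0 ?gt_eqF // expr0n; by case: r pr => [|//]; lra.
  rewrite -powR_mulrn ?subr_ge0 //; apply: ger_powR => //.
  by rewrite subr_gt0 lt_neqAle ne i1 lerBlDr lerDl.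
have := ler_wpM2l (powR_ge0 v%:R p) (bernoulli_ineq r i01).
have -> : v%:R `^ p * (1 - r%:R * v%:R^-1) = v%:R `^ p - r%:R * a.
  rewrite -(mulr_powRB1 (ler0n R v) p0) mulrBr mulr1; congr (_ - _).
  by rewrite -/a; field; rewrite gt_eqF.
by move=> le1 le2; have := le_trans le1 le2; lra.
Qed.

(** Turns a tail bound with the integer exponent [r] into one with a real exponent; it serves with
    [s = p] for active pairs and with [s = p - 1] for samples. *)
Lemma min_power (x s : R) : 0 <= x -> 0 <= s -> s <= r%:R ->
  Num.min 1 (x ^+ r) <= x `^ s.
Proof.
move=> x0 s0 sr; case: (leP x 1) => x1; last first.
  by rewrite ge_min (le_trans _ (ler_powR (ltW x1) s0)) ?powRr0.
have [x00|xn0] := eqVneq x 0; last first.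
  rewrite ge_min -powR_mulrn // ger_powR ?orbT // lt_neqAle eq_sym xn0 x0 //.
rewrite ge_min x00; have [->|sn0] := eqVneq s 0; first by rewrite powRr0 lexx.
case: r sr => [|r' _]; last by rewrite expr0n /= powR_ge0 orbT.
by move=> sr; case/negP: sn0; rewrite eq_le s0 andbT.
Qed.

End Powers.

(** * Levels, thresholds and coin rates *)

Section Analysis.
Variables (R : realType) (p alpha eps K : R) (r k n m h L : nat) (j0 : 'I_n).
Hypotheses (p1 : 1 <= p) (pr : p <= r%:R) (alpha0 : 0 < alpha) (eps0 : 0 < eps)
  (K0 : 0 < K) (k0 : (0 < k)%N) (L0 : (0 < L)%N) (mh : (m <= 2 ^ h.-1)%N).

Definition pow2 (l : nat) : R := (2 ^ l)%:R.
Definition guess (g : 'I_h) : R := pow2 g `^ p.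
Definition ripe (l : 'I_h) (x : nat) : bool := (2 ^ l <= 2 * k * x)%N.
(** The factor 4 is a product of two factors 2: one because the guess may be as large as [2 ^ p]
    times the moment, the other because a count at level [l] may approach [2 ^ l.+1]. *)
Definition allowed : rel 'I_h :=
  fun g l => alpha * guess g <= (4 * pow2 l) `^ p.
(** At these levels the rate [4 * L / 2 ^ l] would be at least 1, so every ripe arrival is reported
    and a single hit is the threshold. *)
Definition low (l : 'I_h) : bool := (2 ^ l <= 4 * L)%N.
Definition thr (l : 'I_h) : nat := if low l then 1 else r.
Definition disc_rate (l : 'I_h) : R :=
  if low l then 1 else (4 * L)%:R / pow2 l.
Definition val_rate (g l : 'I_h) : R :=
  Num.min 1 (K * pow2 l `^ (p - 1) / (eps ^+ 2 * guess g)).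
Definition coin_rate (y : coin_index m h) : R :=
  if y.2 then disc_rate y.1.2 else val_rate y.1.1.2 y.1.2.

Lemma pow2_gt0 l : 0 < pow2 l.
Proof. by rewrite ltr0n expn_gt0. Qed.

Lemma guess_gt0 g : 0 < guess g.
Proof. by rewrite powR_gt0 // pow2_gt0. Qed.

Lemma disc_rate01 l : 0 <= disc_rate l <= 1.
Proof.
rewrite /disc_rate /low; case: ltnP => le; rewrite ?ler01 ?lexx //.
rewrite divr_ge0 ?ler0n //= ler_pdivrMr ?pow2_gt0 // mul1r ler_nat ltnW //.
Qed.

Lemma val_rate_gt0 g l : 0 < val_rate g l.
Proof.
rewrite /val_rate lt_min ltr01 /= divr_gt0 ?mulr_gt0 ?guess_gt0 ?exprn_gt0 //.
by rewrite powR_gt0 // pow2_gt0.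
Qed.

Lemma val_rate_le1 g l : val_rate g l <= 1.
Proof. by rewrite ge_min lexx. Qed.

Lemma coin_rate01 y : 0 <= coin_rate y <= 1.
Proof.
rewrite /coin_rate; case: ifP => _; first exact: disc_rate01.
by rewrite val_rate_le1 ltW // val_rate_gt0.
Qed.

Local Notation coins := (coins 'I_k (coin_index m h)).
Local Notation expect := (expect (I := 'I_k) coin_rate).
Local Notation prob := (prob (I := 'I_k) coin_rate).
Local Notation active := (active j0 allowed thr).
Local Notation top := (top j0 allowed thr).
Local Notation tracked := (tracked j0 allowed thr).
Local Notation polled := (polled j0 allowed thr).
Local Notation extend := (extend j0 allowed thr).
Local Notation volume := (volume k j0 allowed thr).

(* The log of a copy that is never stopped. *)
Definition ulog (w : coins) g past :=
  copy_log j0 ripe allowed thr xpredT w g past.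

Local Arguments total : simpl never.

Local Notation slot past i := (inord (size (site_items past i)) : 'I_m.+1).

Local Arguments ulog : simpl never.

Definition arrival_entry (w : coins) g past (e : arrival k n) : entry n h :=
  Entry e.2 (drawn_hits ripe allowed g (w e.1) (site_items past e.1) e.2)
    (drawn_sample g (w e.1) (site_items past e.1) (top g (ulog w g past) e.2))
    (total (e :: past) e.2).

Lemma ulog_cons w g past e :
  ulog w g (e :: past) = extend g (ulog w g past) (arrival_entry w g past e).
Proof. by []. Qed.

(** * Which coins a log depends on *)

Lemma size_site_items (past : seq (arrival k n)) i :
  (size (site_items past i) <= size past)%N.
Proof. by rewrite size_map size_filter count_size. Qed.

Lemma site_items_cons (past : seq (arrival k n)) e i : site_items (e :: past) i =
  if e.1 == i then e.2 :: site_items past i else site_items past i.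
Proof. by rewrite /site_items /=; case: ifP. Qed.

Lemma set_coin_other (w : coins) i (a : 'I_m.+1) x y z b i' s x' y' z' :
  (s <= m)%N -> (i' = i -> s < a)%N ->
  set_coin w i (a, x, y, z) b i' (inord s, x', y', z') = w i' (inord s, x', y', z').
Proof.
move=> sm lt; rewrite !ffunE; case: eqP => [/lt {}lt|//] /=.
rewrite !xpair_eqE (_ : (inord s == a) = false) //.
by apply/negbTE; rewrite -val_eqE /= inordK // neq_ltn lt.
Qed.

Lemma arrival_entry_set_coin w g past e i (a : 'I_m.+1) x y z b :
  ulog (set_coin w i (a, x, y, z) b) g past = ulog w g past ->
  (size past <= m)%N -> (e.1 = i -> size (site_items past i) < a)%N ->
  arrival_entry (set_coin w i (a, x, y, z) b) g past e = arrival_entry w g past e.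
Proof.
move=> eqlog szm lt; rewrite /arrival_entry eqlog.
have sm : (size (site_items past e.1) <= m)%N.
  exact: leq_trans (size_site_items _ _) szm.
have lt' : (e.1 = i -> size (site_items past e.1) < a)%N by move=> ei; rewrite ei lt.
congr Entry; first by apply/setP => l; rewrite !inE set_coin_other.
by rewrite /drawn_sample; case: (top _ _ _) => // l; rewrite set_coin_other.
Qed.

(** The log reads at site [i] only slots below the number of items there. The bound on [size past]
    keeps [inord] faithful. *)
Lemma ulog_free g past i (a : 'I_m.+1) x y z :
  (size past <= m)%N -> (size (site_items past i) <= a)%N ->
  free_of_coin (fun w => ulog w g past) i (a, x, y, z).
Proof.
elim: past => [//|e past IH] szm le w b; rewrite !ulog_cons.
have eqlog : ulog (set_coin w i (a, x, y, z) b) g past = ulog w g past.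
  apply: IH; first exact: ltnW.
  by apply: leq_trans le; rewrite /site_items /=; case: ifP => //= _; exact: leqnSn.
rewrite eqlog arrival_entry_set_coin // => [|ei]; first exact: ltnW.
by move: le; rewrite /site_items /= ei eqxx.
Qed.

Lemma ulog_free_next (T : Type) (f : seq (entry n h) -> T) g past i x y z :
  (size past <= m)%N ->
  free_of_coin (fun w => f (ulog w g past)) i (slot past i, x, y, z).
Proof.
move=> szm w b; rewrite ulog_free // inordK // ltnS.
exact: leq_trans (size_site_items _ _) szm.
Qed.

(** * Tail bounds for the number of hits *)

Definition may_hit g past l (e : arrival k n) :=
  allowed g l && ripe l (count_mem e.2 (site_items past e.1)).+1.

Lemma hits_cons w g past e l j :
  hits (ulog w g (e :: past)) l j =
  ((e.2 == j) && may_hit g past l e * w e.1 (slot past e.1, g, l, true)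
   + hits (ulog w g past) l j)%N.
Proof.
rewrite ulog_cons hits_extend inE /may_hit; congr (_ + _)%N.
by case: (_ == _) (allowed _ _) (ripe _ _) (w _ _) => [] [] [] [].
Qed.

Lemma total_cons e (past : seq (arrival k n)) j :
  total (e :: past) j = ((e.2 == j) + total past j)%N.
Proof. by []. Qed.

Lemma hits_le_total w g past l j :
  (hits (ulog w g past) l j <= total past j)%N.
Proof.
elim: past => [//|e past IH]; rewrite hits_cons total_cons leq_add //.
by case: (_ == _) (may_hit _ _ _ _) (w _ _) => [] [] [].
Qed.

(** Induction on the arrivals. With rate [d] and bound [x ^ s] so far, a possible new hit gives
    [x ^ s.+1 + d * x ^ s = x ^ s * (x + d)], at most [(x + d) ^ s.+1]. *)
Lemma hits_tail g past l j s : (size past <= m)%N ->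
  expect (fun w => ((s <= hits (ulog w g past) l j)%N)%:R)
  <= (disc_rate l * (total past j)%:R) ^+ s.
Proof.
have /andP[d0 d1] := disc_rate01 l.
elim: past s => [|e past IH] s szm.
  case: s => [|s]; rewrite expect_cst; first by rewrite expr0.
  by rewrite exprn_ge0 // mulr_ge0.
have {}IH s' := IH s' (ltnW szm).
have szm' : (size past <= m)%N by exact: ltnW.
case: s => [|s].
  rewrite expr0 -[leRHS](expect_cst 'I_k coin_rate).
  by apply: (le_expect coin_rate01) => w; rewrite leq0n.
case: (boolP ((e.2 == j) && may_hit g past l e)) => [/andP[/eqP ej hit]|nhit].
  apply: (@le_trans _ _ (expect (fun w =>
      ((s.+1 <= hits (ulog w g past) l j)%N)%:R +
      ((s <= hits (ulog w g past) l j)%N)%:R * (w e.1 (slot past e.1, g, l, true))%:R))).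
    apply: (le_expect coin_rate01) => w.
    rewrite hits_cons ej eqxx hit -natrM -natrD ler_nat.
    case: (w _ _); last by rewrite !muln0 addn0.
    rewrite !muln1 add1n ltnS.
    by case: leqP => _; rewrite ?leq_addl.
  rewrite expectD expect_mul_coin; last first.
    exact: (ulog_free_next (fun lg => ((s <= hits lg l j)%N)%:R)).
  rewrite (_ : coin_rate (_, _, _, true) = disc_rate l) //.
  rewrite total_cons ej eqxx add1n -natr1 mulrDr mulr1.
  apply: le_trans (lerD (IH _) (ler_wpM2l d0 (IH _))) _.
  set x := disc_rate l * _; have x0 : 0 <= x by rewrite mulr_ge0.
  rewrite exprS -mulrDl [leRHS]exprS ler_wpM2l ?addr_ge0 //.
  by rewrite lerXn2r ?nnegrE ?addr_ge0 // lerDl.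
rewrite (eq_expect coin_rate (h2 := fun w => ((s.+1 <= hits (ulog w g past) l j)%N)%:R)).
  apply: le_trans (IH _) _; rewrite lerXn2r ?nnegrE ?mulr_ge0 //.
  by rewrite ler_wpM2l // ler_nat total_cons leq_addl.
by move=> w; rewrite hits_cons (negPf nhit).
Qed.

Lemma active_tail g past l j (s : R) : (size past <= m)%N ->
  0 <= s -> s <= r%:R ->
  expect (fun w => ((thr l <= hits (ulog w g past) l j)%N)%:R)
  <= ((4 * L)%:R * (total past j)%:R / pow2 l) `^ s.
Proof.
move=> szm s0 sr.
have le1 t : expect (fun w => ((t <= hits (ulog w g past) l j)%N)%:R) <= 1.
  rewrite -[leRHS](expect_cst 'I_k coin_rate).
  by apply: (le_expect coin_rate01) => w; rewrite lern1 leq_b1.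
set v := total past j; set x := _ / _.
have xE : x = (4 * L)%:R / pow2 l * v%:R by rewrite /x mulrAC.
have x0 : 0 <= x by rewrite divr_ge0 ?mulr_ge0 ?ler0n // ltW // pow2_gt0.
(* For a count 0 the right side is 0 unless [s = 0]; then the threshold must be positive, which
   follows from [0 < s <= r]. *)
have [v0|v0] := posnP v.
  have [->|sn0] := eqVneq s 0; first by rewrite powRr0.
  have tl : (0 < thr l)%N.
    rewrite /thr; case: (low l) => //; rewrite -(ltr0n R).
    by apply: lt_le_trans sr; rewrite lt_neqAle eq_sym sn0.
  apply: le_trans (powR_ge0 _ _); rewrite le_eqVlt; apply/orP; left; apply/eqP.
  rewrite (eq_expect coin_rate (h2 := (fun=> 0))) ?expect_cst // => w.
  have := hits_le_total w g past l j; rewrite -/v v0 leqn0 => /eqP->.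
  by rewrite leqNgt tl.
rewrite {1}/thr; case: (boolP (low l)) => lw.
  apply: le_trans (le1 _) _; rewrite -(powRr0 x); apply: ler_powR => //.
  rewrite /x ler_pdivlMr ?pow2_gt0 // mul1r -natrM ler_nat.
  by apply: leq_trans lw _; rewrite leq_pmulr.
apply: le_trans (min_power x0 s0 sr); rewrite le_min le1 /=.
by apply: le_trans (hits_tail _ _ _ _ szm) _; rewrite /disc_rate (negPf lw) -xE.
Qed.

Fixpoint may_count g l j (past : seq (arrival k n)) : nat :=
  if past is e :: past' then
    ((e.2 == j) && may_hit g past' l e + may_count g l j past')%N
  else 0.

(** At each site at most [D], the quotient of [2 ^ l] by [2 * k], arrivals of [j] come before
    ripeness; over [k] sites this loses at most [2 ^ l / 2] arrivals. *)
Lemma may_count_ge g l j past : allowed g l ->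
  (2 * total past j <= 2 * may_count g l j past + 2 ^ l)%N.
Proof.
move=> al; set D := (2 ^ l %/ (2 * k))%N.
have gen : (\sum_i (count_mem j (site_items past i) - D) <= may_count g l j past)%N.
  elim: past => [|e past IH]; first by rewrite big1.
  rewrite (bigD1 e.1) //= in IH; rewrite (bigD1 e.1) //=.
  have -> : (\sum_(i | i != e.1) (count_mem j (site_items (e :: past) i) - D)
      = \sum_(i | i != e.1) (count_mem j (site_items past i) - D))%N.
    by apply: eq_bigr => i ne; rewrite site_items_cons ifN // eq_sym.
  rewrite site_items_cons eqxx.
  apply: leq_trans (leq_add (_ : _ <= ((e.2 == j) && may_hit g past l e) +
     (count_mem j (site_items past e.1) - D))%N (leqnn _)) _; last first.
    by rewrite -addnA leq_add2l.
  rewrite /=; case: eqP => [ej|_] /=; last by rewrite add0n.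
  rewrite /may_hit al ej /= add1n.
  case: (boolP (ripe _ _)) => ri; first by lia.
  rewrite add0n leq_subLR; suff lt : (count_mem j (site_items past e.1) < D)%N.
    by rewrite (leq_trans lt) // leq_addr.
  rewrite /D leq_divRL ?muln_gt0 // mulnC ltnW // ltnNge.
  by rewrite /ripe in ri; apply: contra ri.
have : (\sum_i count_mem j (site_items past i)
        <= \sum_(i < k) ((count_mem j (site_items past i) - D) + D))%N.
  by apply: leq_sum => i _; rewrite addnC -leq_subLR.
rewrite sum_site_counts big_split /= sum_nat_const card_ord => le.
have kD : (2 * k * D <= 2 ^ l)%N by rewrite mulnC leq_divM.
apply: leq_trans (leq_mul (leqnn 2) (leq_trans le (leq_add gen (leqnn _)))) _.
by rewrite mulnDr mulnA leq_add2l.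
Qed.

(* Taking [z = 0] and [z = 1/2] bounds the probability of few hits. *)
Lemma expect_exp_hits (z : R) g past l j : (size past <= m)%N ->
  expect (fun w => z ^+ hits (ulog w g past) l j) =
  (1 - disc_rate l + disc_rate l * z) ^+ may_count g l j past.
Proof.
elim: past => [|e past IH] szm.
  by rewrite (eq_expect coin_rate (h2 := (fun=> 1))) ?expect_cst.
have {}IH := IH (ltnW szm).
have szm' : (size past <= m)%N by exact: ltnW.
rewrite [may_count _ _ _ _]/=; case: (boolP (_ && _)) => [may|nmay]; last first.
  rewrite add0n -IH; apply: eq_expect => w.
  by rewrite hits_cons (negPf nmay).
rewrite (eq_expect coin_rate (h2 := (fun w => z ^+ hits (ulog w g past) l j *
    (if w e.1 (slot past e.1, g, l, true) then z else 1)))).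
  rewrite (expect_indep coin_rate (fun b => if b then z else 1)); last first.
    exact: (ulog_free_next (fun lg => z ^+ hits lg l j)).
  rewrite IH add1n exprS; congr (_ * _).
  by rewrite (_ : coin_rate (_, _, _, true) = disc_rate l) // mulr1 addrC.
move=> w; rewrite hits_cons may; case: (w _ _); last by rewrite muln0 add0n mulr1.
by rewrite muln1 add1n exprS mulrC.
Qed.

(** At least [2 ^ l / 2] arrivals may hit. At a low level each of them does; otherwise a Chernoff
    bound with base [1/2] gives [2 ^ r * expR (- L)]. *)
Lemma miss_prob g past l j : (size past <= m)%N -> allowed g l ->
  (2 ^ l <= total past j)%N ->
  expect (fun w => ((hits (ulog w g past) l j < thr l)%N)%:R) <= 2 ^+ r / 2 ^+ L.
Proof.
move=> szm al big.
have mc : (2 ^ l <= 2 * may_count g l j past)%N.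
  have := may_count_ge j past al; lia.
rewrite /thr; case: (boolP (low l)) => lw.
  (* As [0 ^+ 0 = 1], this power of 0 is the indicator of no hit. *)
  rewrite (eq_expect coin_rate (h2 := (fun w => 0 ^+ hits (ulog w g past) l j))).
    rewrite expect_exp_hits // /disc_rate lw mulr0 addr0 subrr expr0n.
    rewrite (_ : may_count _ _ _ _ == 0%N = false) ?divr_ge0 ?exprn_ge0 //.
    by apply/negbTE; rewrite -lt0n; have := expn_gt0 2 l; lia.
  by move=> w; rewrite expr0n ltnS leqn0.
have dE : disc_rate l = (4 * L)%:R / pow2 l by rewrite /disc_rate (negPf lw).
apply: (@le_trans _ _ (expect (fun w => 2 ^+ r * (2^-1) ^+ hits (ulog w g past) l j))).
  apply: (le_expect coin_rate01) => w; case: ltnP => lt; last first.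
    by rewrite mulr_ge0 ?exprn_ge0 ?invr_ge0.
  rewrite exprVn ler_pdivlMr ?exprn_gt0 // mul1r.
  by rewrite ler_eXn2l ?ltr1n // ltnW.
rewrite expectZ expect_exp_hits // ler_wpM2l ?exprn_ge0 //.
have /andP[d0 d1] := disc_rate01 l.
set N := may_count _ _ _ _ in mc *.
have -> : 1 - disc_rate l + disc_rate l / 2 = 1 - disc_rate l / 2 by field.
apply: (@le_trans _ _ (expR (- (disc_rate l / 2)) ^+ N)).
  rewrite lerXn2r ?nnegrE ?expR_ge0 //; first by lra.
  exact: expR_ge1Dx.
rewrite -expRM_natl; apply: (@le_trans _ _ (expR (L%:R * - 1))).
  rewrite ler_expR !mulrN lerN2 mulr1 dE mulrA ler_pdivlMr // mulrA.
  rewrite ler_pdivlMr ?pow2_gt0 // -!natrM ler_nat; nia.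
rewrite expRM_natl -exprVn lerXn2r ?nnegrE ?expR_ge0 ?invr_ge0 //.
rewrite expRN lef_pV2 ?posrE ?expR_gt0 //.
by have := expR_ge1Dx (1 : R); lra.
Qed.

Definition missed_now w g past : bool :=
  [exists x : 'I_h * 'I_n, [&& allowed g x.1, (2 ^ x.1 <= total past x.2)%N
     & (hits (ulog w g past) x.1 x.2 < thr x.1)%N]].

Fixpoint missed w g past : bool :=
  missed_now w g past || (if past is _ :: past' then missed w g past' else false).

Lemma missed_now_prob g past : (size past <= m)%N ->
  prob (missed_now^~ g ^~ past) <= (h * n)%:R * (2 ^+ r / 2 ^+ L).
Proof.
move=> szm; apply: (@le_trans _ _ (prob (fun w => exists x : 'I_h * 'I_n,
  [&& allowed g x.1, (2 ^ x.1 <= total past x.2)%N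
     & (hits (ulog w g past) x.1 x.2 < thr x.1)%N]))).
  by apply: (prob_le coin_rate01) => w /existsP.
apply: le_trans (prob_exists coin_rate01 _) _.
have -> : (h * n)%N = #|{: 'I_h * 'I_n}| by rewrite card_prod !card_ord.
rewrite mulr_natl -sumr_const; apply: ler_sum => -[l j] _ /=.
case: (boolP (allowed g l && (2 ^ l <= total past j)%N)) => [/andP[al big]|nab].
  apply: le_trans (miss_prob szm al big).
  by apply: (le_expect coin_rate01) => w; rewrite asboolb al big.
rewrite [leLHS](eq_expect coin_rate (h2 := (fun=> 0))).
  by rewrite expect_cst divr_ge0 ?exprn_ge0.
by move=> w; rewrite asboolb andbA (negPf nab).
Qed.

Lemma missed_prob g past : (size past <= m)%N ->
  prob (missed^~ g ^~ past) <= (size past).+1%:R * ((h * n)%:R * (2 ^+ r / 2 ^+ L)).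
Proof.
elim: past => [|e past IH] szm.
  rewrite mul1r; apply: le_trans (missed_now_prob g szm).
  by apply: (prob_le coin_rate01) => w; rewrite /= orbF.
have step : prob (missed^~ g ^~ (e :: past)) <=
    prob (missed_now^~ g ^~ (e :: past)) + prob (missed^~ g ^~ past).
  apply: le_trans (prob_or coin_rate01 _ _).
  by apply: (prob_le coin_rate01) => w /orP.
apply: le_trans step _; rewrite -natr1 mulrDl mul1r addrC.
by apply: lerD; [apply: IH; apply: ltnW|exact: missed_now_prob].
Qed.

(** * The error of the estimates and its variance *)

Local Notation pw := (fun v : nat => v%:R `^ p : R).
Local Notation estimate := (estimate j0 allowed thr pw val_rate).
Local Notation gain := (gain p).

Lemma p_neq0 : p != 0.
Proof. by rewrite gt_eqF // (lt_le_trans ltr01). Qed.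

Lemma active_top g lg j l : active g lg l j ->
  exists2 l', top g lg j = Some l' &
    active g lg l' j /\ forall l0, active g lg l0 j -> (l0 <= l')%N.
Proof.
move=> a; rewrite /top; case: pickP => [l' /andP[a' /forallP mx]|no].
  by exists l' => //; split=> // l0 a0; move: (mx l0); rewrite a0.
case: (@arg_maxnP _ l (fun x => active g lg x j) (fun x => x : nat) a) => l' a' mx.
have := no l'; rewrite a' => /negP[]; apply/forallP => l0; apply/implyP.
exact: mx.
Qed.

Lemma top_SomeP g lg j l : top g lg j = Some l ->
  active g lg l j /\ forall l', active g lg l' j -> (l' <= l)%N.
Proof.
rewrite /top; case: pickP => // l' /andP[a /forallP mx] [<-].
by split=> // l0 a0; move: (mx l0); rewrite a0.
Qed.

Lemma top_None g lg j : top g lg j = None -> ~~ tracked g lg j.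
Proof.
move=> t0; apply/existsP => -[l a]; have [l' t _] := active_top a.
by rewrite t0 in t.
Qed.

Lemma top_tracked g lg j l : top g lg j = Some l -> tracked g lg j.
Proof. by move/top_SomeP=> [a _]; apply/existsP; exists l. Qed.

Lemma estimate_extend_other g lg e j : item e != j ->
  estimate g (extend g lg e) j = estimate g lg j.
Proof.
move=> /negPf ne; rewrite /extend; case: ifP => // _.
by case: ifP => _; rewrite /= ne.
Qed.

Lemma estimate_extend_top g lg e l : top g lg (item e) = Some l ->
  estimate g (extend g lg e) (item e) = estimate g lg (item e) +
    (if sampled e then gain (total_seen e) / val_rate g l else 0).
Proof.
move=> t; rewrite /extend; case: ifP => [/andP[_ /negPf->]|_]; first by rewrite addr0.
case: (boolP (polled g lg e)) => [_|np]; first by rewrite /= eqxx t.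
by rewrite /= eqxx t; move: np; rewrite /polled negb_or => /andP[/negPf->].
Qed.

Lemma estimate_extend_fresh g lg e : ~~ tracked g lg (item e) ->
  tracked g (extend g lg e) (item e) ->
  estimate g (extend g lg e) (item e) = (total_seen e)%:R `^ p.
Proof.
move=> nt t; have topN : top g lg (item e) = None.
  by case E : (top _ _ _) => [l|//]; move: nt; rewrite (top_tracked E).
have pol : polled g lg e.
  rewrite /polled; apply/orP; right; case/existsP: t => l a.
  apply/existsP; exists l; rewrite active_cons a andbT.
  by apply: contra nt => a'; apply/existsP; exists l.
move: t; rewrite /extend pol; case: ifP => [_ t|_ t]; first by rewrite t in nt.
by rewrite /= eqxx topN t.
Qed.

Definition moment (past : seq (arrival k n)) : R := \sum_j (total past j)%:R `^ p.

(* With [cut], the increments beyond twice the current level are dropped; this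
   bounds the variance, and changes nothing unless an item was missed. *)
Fixpoint error (cut : bool) w g past : R :=
  if past is e :: past' then
    error cut w g past' +
    (if top g (ulog w g past') e.2 is Some l then
       if cut ==> (total past e.2 <= 2 ^ l.+1)%N then
         gain (total past e.2) *
           ((w e.1 (slot past' e.1, g, l, false))%:R / val_rate g l - 1)
       else 0
     else 0)
  else 0.

Lemma total_self e (past : seq (arrival k n)) :
  total (e :: past) e.2 = (total past e.2).+1.
Proof. by rewrite total_cons eqxx. Qed.

Lemma moment_cons e past :
  moment (e :: past) = moment past + gain (total (e :: past) e.2).
Proof.
rewrite /moment (bigD1 e.2) //= [in RHS](bigD1 e.2) //= total_self.
rewrite addrAC /gain /= subrKC; congr (_ + _); apply: eq_bigr => j ne.
by rewrite total_cons eq_sym (negPf ne).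
Qed.

(** An item contributes no error when it becomes tracked, because the poll gives its exact count.
    Afterwards each arrival contributes its gain times the centred coin [coin / rate - 1]. *)
Lemma sum_estimates w g past :
  \sum_(j | tracked g (ulog w g past) j)
     (estimate g (ulog w g past) j - (total past j)%:R `^ p) = error false w g past.
Proof.
elim: past => [|e past IH].
  by rewrite big1 // => j _; rewrite /= powR0 ?subr0 ?p_neq0.
rewrite [RHS]/= -IH big_mkcond /= [in RHS]big_mkcond (bigD1 e.2) //=.
rewrite [in RHS](bigD1 e.2) //= [RHS]addrAC.
congr (_ + _); last first.
  apply: eq_bigr => j ne; have ne' : e.2 != j by rewrite eq_sym.
  rewrite ulog_cons total_cons (negPf ne') estimate_extend_other //.
  rewrite (_ : tracked _ _ j = tracked g (ulog w g past) j) //.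
  by apply: eq_existsb => l; rewrite active_extend_other.
rewrite ulog_cons; set lg := ulog w g past; set en := arrival_entry w g past e.
have totE : total_seen en = (total past e.2).+1 by exact: total_self.
rewrite total_self.
case E : (top g lg e.2) => [l|].
  have /existsP[l0 a0] := top_tracked E.
  have -> : tracked g (extend g lg en) e.2.
    by apply/existsP; exists l0; exact: active_extend_sub.
  rewrite (top_tracked E) (@estimate_extend_top g lg en l E) totE.
  rewrite (_ : sampled en = w e.1 (slot past e.1, g, l, false)); last first.
    by rewrite /= -/lg E.
  by rewrite /gain /=; case: (w _ _); rewrite ?mulr1n ?mulr0n; ring.
have nt := top_None E; rewrite (negPf nt) addr0.
case: ifP => // t; rewrite (@estimate_extend_fresh g lg en nt t) totE.
exact: subrr.
Qed.

Lemma allowed_up g (l l' : 'I_h) : allowed g l -> (l <= l')%N -> allowed g l'.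
Proof.
move=> al le; apply: le_trans al _; apply: ge0_ler_powR.
- by rewrite ltW // (lt_le_trans ltr01).
- by rewrite nnegrE mulr_ge0 // ltW // pow2_gt0.
- by rewrite nnegrE mulr_ge0 // ltW // pow2_gt0.
- by rewrite ler_wpM2l // ler_nat leq_exp2l.
Qed.

Lemma total_le_size (past : seq (arrival k n)) j : (total past j <= size past)%N.
Proof. exact: count_size. Qed.

(** If the count passed [2 ^ l.+1] with [l] the top level, then level [l.+1] would be allowed and
    reached; as it is not missed, it would be active, against the choice of [l]. It exists because
    counts are at most [2 ^ h.-1]. *)
Lemma error_cut w g past : (size past <= m)%N -> ~~ missed w g past ->
  error true w g past = error false w g past.
Proof.
elim: past => [//|e past IH] szm; rewrite [missed _ _ _]/= negb_or => /andP[_ nm].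
rewrite /= IH //; last exact: ltnW.
congr (_ + _); case E : (top _ _ _) => [l|//]; rewrite ifT //.
have [/andP[al _] mx] := top_SomeP E.
rewrite leqNgt; apply/negP; rewrite total_self ltnS => big.
have lh : (l.+1 < h)%N.
  rewrite ltn_neqAle ltn_ord andbT; apply/eqP => lh.
  have /(leq_trans big) : (total past e.2 <= 2 ^ h.-1)%N.
    by apply: leq_trans (total_le_size _ _) (leq_trans _ mh); rewrite ltnW.
  have -> : h.-1 = l by lia.
  by rewrite leq_exp2l // ltnn.
have /mx : active g (ulog w g past) (Ordinal lh) e.2; last by rewrite /= ltnn.
have al' : allowed g (Ordinal lh) by apply: allowed_up al _; rewrite /= leqnSn.
rewrite /active al' /=; apply/orP; right; rewrite leqNgt.
have : ~~ missed_now w g past by case: (past) nm => [|? ?] /=; rewrite negb_or => /andP[].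
by move=> /existsPn/(_ (Ordinal lh, e.2)) /=; rewrite al' big.
Qed.

Definition variance_factor (g : 'I_h) : R :=
  r%:R * 2 `^ (p - 1) * (eps ^+ 2 * guess g / K).

Lemma variance_factor_ge0 g : 0 <= variance_factor g.
Proof.
apply: mulr_ge0; first by rewrite mulr_ge0 ?powR_ge0.
by rewrite divr_ge0 ?mulr_ge0 ?exprn_ge0 // ltW // guess_gt0.
Qed.

Lemma gain_ge0 v : 0 <= gain v.
Proof.
case: v => [|v]; first by rewrite /gain subrr.
exact: le_trans (powR_ge0 _ _) (gain_ge p1 (ltn0Sn v)).
Qed.

(** The gain is at most a constant times [(2 ^ l) ^ (p - 1)], and the inverse rate is inversely
    proportional to the same power, so the level cancels. At rate 1 there is no variance. *)
Lemma step_variance g (l : 'I_h) v : (0 < v)%N -> (v <= 2 ^ l.+1)%N ->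
  gain v * ((1 - val_rate g l) / val_rate g l) <= variance_factor g.
Proof.
move=> v0 vle; have q0 := val_rate_gt0 g l; have q1 := val_rate_le1 g l.
have G0 := guess_gt0 g; have P0 := pow2_gt0 l.
have [q1'|qn1] := eqVneq (val_rate g l) 1.
  by rewrite q1' subrr mul0r mulr0 variance_factor_ge0.
have Pp : 0 < pow2 l `^ (p - 1) by rewrite powR_gt0.
have p10 : 0 <= p - 1 by rewrite subr_ge0.
have qE : (val_rate g l)^-1 = eps ^+ 2 * guess g / (K * pow2 l `^ (p - 1)).
  move: qn1; rewrite /val_rate; case: leP => [|_]; first by rewrite eqxx.
  by rewrite invf_div.
have le1 : (1 - val_rate g l) / val_rate g l <=
    eps ^+ 2 * guess g / (K * pow2 l `^ (p - 1)).
  by rewrite -qE ler_pdivrMr // mulVf ?gt_eqF // lerBlDr lerDl ltW.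
have le2 : gain v <= r%:R * (2 `^ (p - 1) * pow2 l `^ (p - 1)).
  apply: le_trans (gain_le p1 pr v0) _; rewrite ler_wpM2l //.
  rewrite -powRM ?(ltW P0) //.
  apply: ge0_ler_powR; rewrite ?nnegrE ?mulr_ge0 ?(ltW P0) //.
  by rewrite /pow2 -natrM ler_nat -expnS.
apply: le_trans (ler_pM _ _ le2 le1) _; first exact: gain_ge0.
  by rewrite divr_ge0 ?subr_ge0 // ltW.
rewrite le_eqVlt /variance_factor; apply/orP; left; apply/eqP.
by field; rewrite !gt_eqF.
Qed.

Lemma error_free cut g past i (a : 'I_m.+1) x y z :
  (size past <= m)%N -> (size (site_items past i) <= a)%N ->
  free_of_coin (fun w => error cut w g past) i (a, x, y, z).
Proof.
elim: past => [//|e past IH] szm le w b.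
have szm' : (size past <= m)%N by exact: ltnW.
have le' : (size (site_items past i) <= a)%N.
  by apply: leq_trans le; rewrite site_items_cons; case: ifP => //= _; exact: leqnSn.
rewrite /= (IH szm' le') (ulog_free g _ _ _ szm' le'); congr (_ + _).
case: (top _ _ _) => // l; case: ifP => // _; rewrite set_coin_other //.
  exact: leq_trans (size_site_items _ _) szm'.
by move=> ei; move: le; rewrite site_items_cons ei eqxx.
Qed.

Lemma moment_ge0 past : 0 <= moment past.
Proof. by apply: sumr_ge0 => j _; exact: powR_ge0. Qed.

(** The increments are martingale differences: the cross terms vanish, and each square contributes
    at most [variance_factor g] times a gain. The gains telescope to the moment. *)
Lemma error_second_moment g past : (size past <= m)%N ->
  expect (fun w => error true w g past ^+ 2) <= variance_factor g * moment past.
Proof.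
elim: past => [|e past IH] szm.
  rewrite (eq_expect coin_rate (h2 := (fun=> 0))) => [|w]; last by rewrite expr0n.
  by rewrite expect_cst mulr_ge0 ?variance_factor_ge0 ?moment_ge0.
have szm' : (size past <= m)%N by exact: ltnW.
set v := total (e :: past) e.2.
have v0 : (0 < v)%N by rewrite /v total_self.
(* The coin that is read depends on the random top level; summing over [l] with the indicator [A l]
   lets each term involve one fixed coin. *)
pose A l (w : coins) : R :=
  ((top g (ulog w g past) e.2 == Some l) && (v <= 2 ^ l.+1)%N)%:R.
pose xi l (b : bool) : R := b%:R / val_rate g l - 1.
pose c l (w : coins) := w e.1 (slot past e.1, g, l, false).
have slotE : (size (site_items past e.1) <= (slot past e.1 : 'I_m.+1))%N.
  by rewrite inordK // ltnS (leq_trans (size_site_items _ _)).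
have sqE w : error true w g (e :: past) ^+ 2 = error true w g past ^+ 2 +
    (\sum_l (2 * gain v * (error true w g past * A l w)) * xi l (c l w) +
     \sum_l (gain v ^+ 2 * A l w) * xi l (c l w) ^+ 2).
  rewrite /= -/v; case E : (top g (ulog w g past) e.2) => [l|]; last first.
    by rewrite !big1 ?addr0 // => l _; rewrite /A E /= ?mulr0 mul0r.
  have A0 l' : l' != l -> A l' w = 0.
    by move=> nl; rewrite /A E (inj_eq Some_inj) eq_sym (negPf nl).
  rewrite (bigD1 l) //= [X in _ + (_ + X)](bigD1 l) //=.
  rewrite big1 => [|l' /A0->]; last by rewrite !mulr0 mul0r.
  rewrite big1 => [|l' /A0->]; last by rewrite !mulr0 mul0r.
  rewrite !addr0.
  rewrite /A E eqxx /=; case: ifP => _; last by rewrite !mulr0 !mul0r !addr0.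
  by rewrite /xi /c !mulr1n; ring.
rewrite (eq_expect _ sqE) expectD expectD !expect_sum moment_cons [leRHS]mulrDr.
apply: lerD; first exact: IH.
(* The cross terms: [xi l] has mean 0, and its coin is fresh. *)
rewrite big1 ?add0r => [|l _]; last first.
  rewrite (expect_indep coin_rate (xi l)); last first.
    by move=> w b; rewrite /A error_free // ulog_free.
  rewrite (_ : coin_rate (_, _, _, false) = val_rate g l) // /xi /=.
  have := val_rate_gt0 g l; move: (val_rate g l) => q q0.
  by rewrite (_ : _ + _ = 0) ?mul0r //; field; rewrite gt_eqF.
apply: (@le_trans _ _ (expect (fun w => \sum_l gain v * variance_factor g * A l w))).
  rewrite expect_sum; apply: ler_sum => l _.
  rewrite (expect_indep coin_rate (fun b => xi l b ^+ 2)); last first.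
    by move=> w b; rewrite /A ulog_free.
  rewrite !expectZ (_ : coin_rate (_, _, _, false) = val_rate g l) //.
  rewrite mulrA; case: (leqP v (2 ^ l.+1)) => vle; last first.
    rewrite (eq_expect coin_rate (h2 := (fun=> 0))) => [|w]; last first.
      by rewrite /A leqNgt vle andbF.
    by rewrite expect_cst !mulr0.
  apply: ler_wpM2r; first by apply: (expect_ge0 coin_rate01) => w; rewrite ler0n.
  have := ler_wpM2l (gain_ge0 v) (step_variance g v0 vle).
  have := val_rate_gt0 g l; rewrite /xi; move: (val_rate g l) => q q0.
  apply: le_trans; rewrite le_eqVlt; apply/orP; left; apply/eqP => /=.
  by field; rewrite gt_eqF.
rewrite -[leRHS]mulr1 -[X in _ <= _ * X](expect_cst 'I_k coin_rate) -expectZ.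
apply: (le_expect coin_rate01) => w; rewrite -mulr_sumr [gain v * _]mulrC.
apply: ler_wpM2l; first by rewrite mulr_ge0 ?variance_factor_ge0 ?gain_ge0.
rewrite /A; case: (top _ _ _) => [l|]; last by rewrite big1.
rewrite (bigD1 l) //= big1 ?addr0 ?lern1 ?leq_b1 // => l' nl.
by rewrite (inj_eq Some_inj) eq_sym (negPf nl).
Qed.

(** * Expected communication of one copy *)

Lemma natr_card_set (T : finType) (P : pred T) :
  (#|[set x | P x]|)%:R = \sum_x (P x)%:R :> R.
Proof.
rewrite -sum1_card natr_sum big_mkcond; apply: eq_bigr => x _.
by rewrite inE; case: (P x).
Qed.

Lemma allowed_inv g l : allowed g l ->
  (pow2 l `^ p)^-1 <= 4 `^ p / (alpha * guess g).
Proof.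
move=> al; have P0 : 0 < pow2 l `^ p by rewrite powR_gt0 // pow2_gt0.
rewrite ler_pdivlMr ?mulr_gt0 ?guess_gt0 // ler_pdivrMl // [leRHS]mulrC.
by rewrite -powRM ?(ltW (pow2_gt0 l)).
Qed.

Lemma powR_split x : 0 <= x -> x * x `^ (p - 1) = x `^ p.
Proof. by move=> x0; rewrite mulr_powRB1 // (lt_le_trans ltr01). Qed.

Lemma p1_ge0 : 0 <= p - 1. Proof. by rewrite subr_ge0. Qed.

Lemma le_powR_nat (x y : nat) : (x <= y)%N -> x%:R `^ (p - 1) <= y%:R `^ (p - 1) :> R.
Proof. by move=> xy; apply: ge0_ler_powR; rewrite ?nnegrE ?p1_ge0 ?ler_nat. Qed.

Lemma sum_ord_cst (c : R) : \sum_(l < h) c = h%:R * c.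
Proof. by rewrite sumr_const card_ord mulr_natl. Qed.

Definition hit_cost (g : 'I_h) : R :=
  h%:R * ((4 * L)%:R * (2 * k)%:R `^ (p - 1) * (4 `^ p / (alpha * guess g))).

(** Ripeness gives [2 ^ l <= 2 * k * v], so the rate may be multiplied by
    [(2 * k * v / 2 ^ l) ^ (p - 1)]; [allowed] then bounds the resulting [1 / (2 ^ l) ^ p]. This is
    the source of [k ^ (p - 1) / alpha]. *)
Lemma may_hit_rate g past l e : may_hit g past l e ->
  disc_rate l <= (4 * L)%:R * (2 * k)%:R `^ (p - 1) * (4 `^ p / (alpha * guess g)) *
    (total (e :: past) e.2)%:R `^ (p - 1).
Proof.
case/andP=> al ri; set v := total _ _; have P0 := pow2_gt0 l.
have xv : ((count_mem e.2 (site_items past e.1)).+1 <= v)%N.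
  rewrite /v total_self ltnS -sum_site_counts (bigD1 e.1) //=; exact: leq_addr.
have {}ri : (2 ^ l <= 2 * k * v)%N by apply: leq_trans ri _; rewrite leq_mul2l xv orbT.
have rate_le : disc_rate l <= (4 * L)%:R / pow2 l.
  rewrite /disc_rate; case: (boolP (low l)) => // lw.
  by rewrite ler_pdivlMr // mul1r ler_nat.
have one : 1 <= (2 * k)%:R `^ (p - 1) * v%:R `^ (p - 1) / pow2 l `^ (p - 1).
  rewrite ler_pdivlMr ?powR_gt0 // mul1r -powRM ?ler0n // -natrM.
  exact: le_powR_nat.
apply: le_trans rate_le _; rewrite -[leLHS]mulr1.
apply: le_trans (ler_wpM2l _ one) _; first by rewrite divr_ge0 // ltW.
set a := _ `^ _; set b := _ `^ (p - 1).
have -> : (4 * L)%:R / pow2 l * (a * b / pow2 l `^ (p - 1)) =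
    (4 * L)%:R * a * b * (pow2 l `^ p)^-1.
  rewrite -(powR_split (ltW P0)); field.
  by rewrite !gt_eqF // powR_gt0.
rewrite [leRHS]mulrAC ler_wpM2l ?allowed_inv // !mulr_ge0 ?powR_ge0 //.
Qed.

Lemma expect_hits g past e : (size past <= m)%N ->
  expect (fun w => (#|levels_hit (arrival_entry w g past e)|)%:R)
  <= hit_cost g * (total (e :: past) e.2)%:R `^ (p - 1).
Proof.
move=> szm.
rewrite (eq_expect coin_rate (h2 := (fun w => \sum_l (may_hit g past l e)%:R *
    (w e.1 (slot past e.1, g, l, true))%:R))); last first.
  move=> w; rewrite natr_card_set; apply: eq_bigr => l _.
  by rewrite -natrM mulnb /may_hit andbA.
rewrite expect_sum /hit_cost -[leRHS]mulrA -sum_ord_cst.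
apply: ler_sum => l _; rewrite (expect_mul_coin coin_rate) //.
rewrite expect_cst (_ : coin_rate (_, _, _, true) = disc_rate l) //.
case: (boolP (may_hit _ _ _ _)) => [mh'|_].
  by rewrite mulr1; exact: may_hit_rate.
rewrite mulr0; apply: mulr_ge0; last exact: powR_ge0.
apply: mulr_ge0; first by rewrite mulr_ge0 ?powR_ge0.
by rewrite divr_ge0 ?powR_ge0 // ltW // mulr_gt0 // guess_gt0.
Qed.

Lemma active_le w g past l j : ((active g (ulog w g past) l j)%:R : R) <=
  ((j == j0) && (l == g))%:R +
  (allowed g l)%:R * (thr l <= hits (ulog w g past) l j)%:R.
Proof.
rewrite /active -natrM -natrD ler_nat mulnb.
by case: (allowed g l) => //=; case: (_ && _).
Qed.

Lemma expect_active g past l j s : (size past <= m)%N -> 0 <= s -> s <= r%:R ->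
  expect (fun w => (active g (ulog w g past) l j)%:R) <=
  ((j == j0) && (l == g))%:R +
  (allowed g l)%:R * ((4 * L)%:R * (total past j)%:R / pow2 l) `^ s.
Proof.
move=> szm s0 sr.
apply: le_trans (le_expect coin_rate01 (fun w => active_le w g past l j)) _.
rewrite expectD expect_cst expectZ lerD2l ler_wpM2l //.
exact: active_tail.
Qed.

Definition sample_cost (g : 'I_h) : R :=
  h%:R * (K * (4 * L)%:R `^ (p - 1) / (eps ^+ 2 * guess g)).

(** Level [l] is active with probability at most [(4 * L * v / 2 ^ l) ^ (p - 1)], apart from [j0],
    and the sampling rate is proportional to [(2 ^ l) ^ (p - 1)]: the level cancels. The last term
    is for [j0] at level [g]. *)
Lemma expect_sampled g past e : (size past <= m)%N ->
  expect (fun w => (sampled (arrival_entry w g past e))%:R)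
  <= sample_cost g * (total (e :: past) e.2)%:R `^ (p - 1)
     + (e.2 == j0)%:R * (K / (eps ^+ 2 * pow2 g)).
Proof.
move=> szm; set v := total _ _.
have e20 : 0 < eps ^+ 2 by rewrite exprn_gt0.
have pr1 : p - 1 <= r%:R by rewrite (le_trans _ pr) // gerBl.
apply: (@le_trans _ _ (expect (fun w => \sum_l (active g (ulog w g past) l e.2)%:R *
    (w e.1 (slot past e.1, g, l, false))%:R))).
  apply: (le_expect coin_rate01) => w /=.
  case E : (top _ _ _) => [l|]; last first.
    by apply: sumr_ge0 => l _; rewrite mulr_ge0.
  have [a _] := top_SomeP E; rewrite (bigD1 l) //= a mul1r lerDl.
  by apply: sumr_ge0 => l' _; rewrite mulr_ge0.
rewrite expect_sum.
apply: (@le_trans _ _ (\sum_l (K * (4 * L)%:R `^ (p - 1) / (eps ^+ 2 * guess g) *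
    v%:R `^ (p - 1) + ((e.2 == j0) && (l == g))%:R * (K / (eps ^+ 2 * pow2 g))))).
  apply: ler_sum => l _; have P0 := pow2_gt0 l; have G0 := guess_gt0 g.
  rewrite (expect_mul_coin coin_rate); last first.
    exact: (ulog_free_next (fun lg => (active g lg l e.2)%:R)).
  rewrite (_ : coin_rate (_, _, _, false) = val_rate g l) //.
  have q0 := val_rate_gt0 g l.
  have qle : val_rate g l <= K * pow2 l `^ (p - 1) / (eps ^+ 2 * guess g).
    by rewrite /val_rate ge_min lexx orbT.
  apply: le_trans (ler_wpM2l (ltW q0) (expect_active g l e.2 szm p1_ge0 pr1)) _.
  rewrite mulrDr addrC; apply: lerD.
    apply: (@le_trans _ _ (val_rate g l *
        ((4 * L)%:R * (total past e.2)%:R / pow2 l) `^ (p - 1))).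
      rewrite ler_wpM2l ?(ltW q0) //; case: (allowed g l); first by rewrite mul1r.
      by rewrite mul0r powR_ge0.
    apply: le_trans (ler_wpM2r (powR_ge0 _ _) qle) _.
    have XY : ((4 * L)%:R * (total past e.2)%:R / pow2 l) `^ (p - 1) *
        pow2 l `^ (p - 1) = (4 * L)%:R `^ (p - 1) * (total past e.2)%:R `^ (p - 1).
      by rewrite -powRM ?divr_ge0 ?mulr_ge0 ?(ltW P0) // divfK ?gt_eqF // powRM.
    have vv : (total past e.2)%:R `^ (p - 1) <= v%:R `^ (p - 1) :> R.
      by rewrite le_powR_nat // /v total_self.
    have KD : 0 <= K / (eps ^+ 2 * guess g).
      by rewrite ltW // divr_gt0 // mulr_gt0.
    rewrite [leLHS](_ : _ = K / (eps ^+ 2 * guess g) *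
      ((4 * L)%:R `^ (p - 1) * (total past e.2)%:R `^ (p - 1))); last first.
      by rewrite -XY; ring.
    rewrite [leRHS](_ : _ = K / (eps ^+ 2 * guess g) *
      ((4 * L)%:R `^ (p - 1) * v%:R `^ (p - 1))); last by ring.
    by rewrite ler_wpM2l // ler_wpM2l // powR_ge0.
  case: (boolP (_ && _)) => [/andP[_ /eqP->]|_]; last by rewrite mulr0 mul0r.
  rewrite mulr1 mul1r.
  apply: le_trans (_ : _ <= K * pow2 g `^ (p - 1) / (eps ^+ 2 * guess g)) _.
    by rewrite /val_rate ge_min lexx orbT.
  rewrite /guess -(powR_split (ltW (pow2_gt0 g))) le_eqVlt; apply/orP; left; apply/eqP.
  field; rewrite !gt_eqF ?powR_gt0 ?pow2_gt0 //.
rewrite big_split /= sum_ord_cst /sample_cost -[X in _ <= X + _]mulrA lerD2l.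
rewrite -mulr_suml (bigD1 g) //= eqxx andbT big1 ?addr0 //.
by move=> l /negPf->; rewrite andbF.
Qed.

(** The costs per arrival are multiples of [v ^ (p - 1)], which is at most the gain, so they sum to
    a multiple of the moment. *)
Lemma expect_reports g past : (size past <= m)%N ->
  expect (fun w => (reports k (ulog w g past))%:R) <=
  (hit_cost g + k%:R * sample_cost g) * moment past
  + k%:R * (K / (eps ^+ 2 * pow2 g)) * (total past j0)%:R.
Proof.
have c0 : 0 <= hit_cost g + k%:R * sample_cost g.
  have a0 : 0 < alpha * guess g by rewrite mulr_gt0 // guess_gt0.
  have b0 : 0 < eps ^+ 2 * guess g by rewrite mulr_gt0 ?guess_gt0 // exprn_gt0.
  rewrite addr_ge0 // /hit_cost /sample_cost ?mulr_ge0 ?powR_ge0 ?invr_ge0 //.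
  - exact: ltW.
  - exact: ltW.
  - exact: ltW.
elim: past => [|e past IH] szm.
  by rewrite expect_cst addr_ge0 ?mulr_ge0 ?moment_ge0 //
    ltW // invr_gt0 mulr_gt0 ?pow2_gt0 ?exprn_gt0.
have szm' : (size past <= m)%N by exact: ltnW.
rewrite (eq_expect coin_rate (h2 := (fun w =>
    (#|levels_hit (arrival_entry w g past e)|)%:R
    + k%:R * (sampled (arrival_entry w g past e))%:R
    + (reports k (ulog w g past))%:R))); last first.
  by move=> w; rewrite ulog_cons reports_extend !natrD natrM.
rewrite !expectD expectZ.
apply: le_trans (lerD (lerD (expect_hits g e szm') (ler_wpM2l (ler0n R k)
  (expect_sampled g e szm'))) (IH szm')) _.
rewrite moment_cons [total (e :: past) j0]total_cons natrD.
have := gain_ge p1 (v := total (e :: past) e.2); rewrite {1}total_self => /(_ isT).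
move/(ler_wpM2l c0); move: (_ `^ (p - 1)) (gain _) => x y.
set c := K / _; move: (hit_cost g) (sample_cost g) => a b.
case: (e.2 == j0) => /=; rewrite ?mulr1n ?mulr0n; lra.
Qed.

Lemma expect_active_pairs g past : (size past <= m)%N ->
  expect (fun w => (#|active_pairs j0 allowed thr g (ulog w g past)|)%:R) <=
  1 + h%:R * ((16 * L)%:R `^ p / (alpha * guess g)) * moment past.
Proof.
move=> szm.
rewrite (eq_expect coin_rate (h2 := (fun w => \sum_(x : 'I_h * 'I_n)
    (active g (ulog w g past) x.1 x.2)%:R))); last by move=> w; exact: natr_card_set.
rewrite expect_sum; have p0 : 0 <= p by rewrite (le_trans ler01).
apply: (@le_trans _ _ (\sum_(x : 'I_h * 'I_n) (((x.2 == j0) && (x.1 == g))%:R +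
    (16 * L)%:R `^ p / (alpha * guess g) * (total past x.2)%:R `^ p))).
  apply: ler_sum => -[l j] _ /=.
  apply: le_trans (expect_active g l j szm p0 pr) _; rewrite lerD2l.
  have c0 : 0 <= (16 * L)%:R `^ p / (alpha * guess g) * (total past j)%:R `^ p.
    by rewrite mulr_ge0 ?powR_ge0 // divr_ge0 ?powR_ge0 // ltW // mulr_gt0 ?guess_gt0.
  case: (boolP (allowed g l)) => [al|_]; last by rewrite mul0r.
  have P0 := pow2_gt0 l.
  have E : ((4 * L)%:R * (total past j)%:R / pow2 l) `^ p * pow2 l `^ p =
      (4 * L)%:R `^ p * (total past j)%:R `^ p.
    by rewrite -powRM ?divr_ge0 ?mulr_ge0 ?(ltW P0) // divfK ?gt_eqF // powRM.
  have P1 : 0 < pow2 l `^ p by rewrite powR_gt0.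
  rewrite mul1r -[leLHS](mulfK (lt0r_neq0 P1)) E.
  apply: le_trans (ler_wpM2l _ (allowed_inv al)) _; first by rewrite mulr_ge0 ?powR_ge0.
  have -> : (16 * L)%:R = 4 * (4 * L)%:R :> R by rewrite -natrM mulnA.
  by rewrite [in leRHS]powRM // le_eqVlt; apply/orP; left; apply/eqP; ring.
rewrite big_split /= lerD //.
  rewrite (bigD1 (g, j0)) //= !eqxx big1 ?addr0 // => -[l j].
  by rewrite xpair_eqE andbC /= => /negPf->.
rewrite -(pair_big xpredT xpredT (fun (l : 'I_h) (j : 'I_n) =>
  (16 * L)%:R `^ p / (alpha * guess g) * (total past j)%:R `^ p)) /=.
by rewrite sum_ord_cst -mulr_sumr mulrA.
Qed.

(** The terms stand for hits, samples at discovered levels, samples caused by the initial activity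
    of [j0], and active pairs. *)
Definition volume_bound : R :=
  h%:R * ((4 * L)%:R * (2 * k)%:R `^ (p - 1) * (4 `^ p / alpha))
  + k%:R * (h%:R * (K * (4 * L)%:R `^ (p - 1) / eps ^+ 2))
  + k%:R * (K / eps ^+ 2)
  + k%:R * (1 + h%:R * ((16 * L)%:R `^ p / alpha)).

Lemma total_le_guess g past j : moment past <= guess g -> (total past j)%:R <= pow2 g.
Proof.
move=> Mg; have p0 : 0 < p by rewrite (lt_le_trans ltr01).
rewrite leNgt; apply/negP => lt.
have lt' : guess g < (total past j)%:R `^ p.
  by apply: gt0_ltr_powR; rewrite ?nnegrE ?ler0n // ltW ?pow2_gt0.
have : (total past j)%:R `^ p <= guess g.
  apply: le_trans Mg; rewrite /moment (bigD1 j) //= lerDl.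
  by apply: sumr_ge0 => ? _; exact: powR_ge0.
by rewrite leNgt lt'.
Qed.

Lemma expect_volume g past : (size past <= m)%N -> moment past <= guess g ->
  expect (fun w => (volume g (ulog w g past))%:R) <= volume_bound.
Proof.
move=> szm Mg; have G0 := guess_gt0 g; have P0 := pow2_gt0 g.
rewrite (eq_expect coin_rate (h2 := (fun w => (reports k (ulog w g past))%:R +
  k%:R * (#|active_pairs j0 allowed thr g (ulog w g past)|)%:R))); last first.
  by move=> w; rewrite /volume natrD natrM.
rewrite expectD expectZ.
apply: le_trans (lerD (expect_reports g szm)
  (ler_wpM2l (ler0n R k) (expect_active_pairs g szm))) _.
rewrite /volume_bound /hit_cost /sample_cost; apply: lerD.
  have e20 : 0 < eps ^+ 2 by rewrite exprn_gt0.
  apply: lerD; last first.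
    apply: le_trans (ler_wpM2l _ (total_le_guess j0 Mg)) _.
      by rewrite mulr_ge0 // ltW // divr_gt0 // mulr_gt0.
    by rewrite le_eqVlt; apply/orP; left; apply/eqP; field; rewrite !gt_eqF.
  apply: le_trans (ler_wpM2l _ Mg) _.
    rewrite addr_ge0 ?mulr_ge0 ?powR_ge0 ?invr_ge0 ?mulr_ge0 //; exact: ltW.
  by rewrite le_eqVlt; apply/orP; left; apply/eqP; field; rewrite !gt_eqF.
apply: ler_wpM2l => //; rewrite lerD2l -!mulrA ler_wpM2l // ler_wpM2l ?powR_ge0 //.
by rewrite ler_pdivrMl ?mulr_gt0 // mulrAC mulfV ?gt_eqF // mul1r.
Qed.

(** * Choice of the constants and failure probabilities *)

Variables (b B : nat).
Hypotheses (h0 : (0 < h)%N) (nb : (n <= 2 ^ b)%N) (LE : L = (7 + r + b + 3 * h)%N)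
  (KE : K = (100 * r * 4 ^ r * h)%:R) (BV : 20 * volume_bound <= B%:R).

Local Notation live := (live k j0 allowed thr B).

Definition clog (w : coins) g past := copy_log j0 ripe allowed thr (live g) w g past.

(** A stopped copy keeps its oversized log forever; a copy that is live now was therefore never
    stopped. *)
Lemma clog_of_live w g past : live g (clog w g past) -> clog w g past = ulog w g past.
Proof.
elim: past => [//|e past IH]; rewrite /clog /= -/(clog w g past).
case: (boolP (live g (clog w g past))) => [lv _|nl lv]; last by rewrite lv in nl.
by rewrite ulog_cons /arrival_entry IH.
Qed.

Lemma clog_of_ulog_live w g past : live g (ulog w g past) -> clog w g past = ulog w g past.
Proof.
elim: past => [//|e past IH] lv.
have lv' : live g (ulog w g past).
  by apply: leq_trans lv; rewrite ulog_cons volume_extend.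
by rewrite /clog /= -/(clog w g past) IH // lv'.
Qed.

Lemma sum_total (past : seq (arrival k n)) : (\sum_j total past j)%N = size past.
Proof.
elim: past => [|e past IH]; first by rewrite big1.
under eq_bigr do rewrite total_cons.
rewrite big_split /= IH (bigD1 e.2) //= eqxx big1 ?addn0 ?add1n //.
by move=> j; rewrite eq_sym => /negPf->.
Qed.

Lemma moment_le_size past : moment past <= (size past)%:R `^ p.
Proof.
rewrite -powR_split ?ler0n // -{1}(sum_total past) natr_sum mulr_suml.
apply: ler_sum => j _; rewrite -powR_split ?ler0n // ler_wpM2l //.
by apply: le_powR_nat; exact: total_le_size.
Qed.

Lemma moment_ge1 past : (0 < size past)%N -> 1 <= moment past.
Proof.
case: past => // e past _; rewrite moment_cons -[leLHS]add0r lerD ?moment_ge0 //.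
apply: le_trans (gain_ge p1 _); last by rewrite total_self.
have {1}-> : 1 = 1%:R `^ (p - 1) :> R by rewrite powR1.
by rewrite le_powR_nat // total_self.
Qed.

(** Take the least guess above the moment. Minimality gives the upper bound, except for the guess 1,
    where the moment is at least 1. *)
Lemma exists_guess past : (0 < size past)%N -> (size past <= m)%N ->
  exists g, moment past <= guess g /\ guess g <= 2 `^ p * moment past.
Proof.
move=> s0 szm; have p0 : 0 <= p by rewrite (le_trans ler01).
pose Q g := (g < h)%N && (moment past <= pow2 g `^ p).
have exQ : exists g, Q g.
  exists h.-1; rewrite /Q prednK // leqnn /=; apply: le_trans (moment_le_size _) _.
  by apply: ge0_ler_powR; rewrite ?nnegrE ?ler0n // ler_nat (leq_trans szm).
case: (ex_minnP exQ) => g /andP[gh Mg] mn; exists (Ordinal gh); split=> //.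
rewrite /guess /=; case: g gh Mg mn => [|g] gh Mg mn.
  rewrite /pow2 expn0 mulr1n powR1 -[leLHS]mulr1; apply: ler_pM => //.
    by rewrite -[leLHS](powRr0 2) ler_powR // ler1n.
  exact: moment_ge1.
have /negP : ~ Q g by move=> /mn; rewrite ltnn.
rewrite /Q (ltn_trans (ltnSn g) gh) /= -ltNge => /ltW lt.
rewrite /pow2 expnS natrM powRM //; apply: ler_wpM2l => //; exact: powR_ge0.
Qed.

(** The smallest live guess depends on the coins and may lie below the moment, hence the second
    condition ranges over all guesses up to [2 ^ p] times the moment. *)
Definition reliable w past : Prop :=
  (exists g, [/\ moment past <= guess g, guess g <= 2 `^ p * moment past
                & live g (ulog w g past)]) /\
  forall g, guess g <= 2 `^ p * moment past ->
    ~~ missed w g past /\ `|error true w g past| <= eps * moment past.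

Lemma r_gt0 : (0 < r)%N.
Proof. by rewrite -(ltr0n R) (lt_le_trans _ pr) // (lt_le_trans ltr01). Qed.

(** Chebyshev's inequality; [K] is chosen to absorb [r * 2 ^ (p - 1) * 2 ^ p], at most [r * 4 ^ r],
    and to leave [1 / (100 * h)] for a union over the guesses. *)
Lemma error_prob g past : (0 < size past)%N -> (size past <= m)%N ->
  guess g <= 2 `^ p * moment past ->
  prob (fun w => eps * moment past < `|error true w g past|) <= (100 * h%:R)^-1.
Proof.
move=> s0 szm Gg; set M := moment past.
have M0 : 0 < M by rewrite (lt_le_trans ltr01) // moment_ge1.
have eM : 0 < (eps * M) ^+ 2 by rewrite exprn_gt0 // mulr_gt0.
apply: le_trans (markov coin_rate01 (h := fun w => error true w g past ^+ 2) eM _ _) _.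
- by move=> w; rewrite sqr_ge0.
- move=> w lt; rewrite -[leRHS]real_normK ?num_real // lerXn2r ?nnegrE ?(ltW lt) //.
  by rewrite mulr_ge0 // ltW.
rewrite ler_pdivrMr //; apply: le_trans (error_second_moment _ szm) _; rewrite -/M.
have hR : 0 < h%:R :> R by rewrite ltr0n.
have rR : 0 < r%:R :> R by rewrite ltr0n r_gt0.
have p42 : 2 `^ (p - 1) * 2 `^ p <= 4 ^+ r :> R.
  rewrite -powRD; last by rewrite pnatr_eq0 implybT.
  rewrite -powR_mulrn // (_ : 4 = 2 `^ 2); last by rewrite powR_mulrn // -natrX.
  rewrite -powRrM ler_powR ?ler1n // mulr_natl mulr2n lerD // (le_trans _ pr) //.
  by rewrite gerBl.
rewrite /variance_factor.
have step : r%:R * 2 `^ (p - 1) * (eps ^+ 2 * guess g / K) * M <=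
   r%:R * 2 `^ (p - 1) * (eps ^+ 2 * (2 `^ p * M) / K) * M.
  rewrite ler_wpM2r ?(ltW M0) // ler_wpM2l ?mulr_ge0 ?powR_ge0 //.
  by rewrite ler_wpM2r ?invr_ge0 ?(ltW K0) // ler_wpM2l ?exprn_ge0 ?(ltW eps0).
apply: le_trans step _.
have -> : r%:R * 2 `^ (p - 1) * (eps ^+ 2 * (2 `^ p * M) / K) * M =
    2 `^ (p - 1) * 2 `^ p * (r%:R * (eps * M) ^+ 2 / K) by ring.
apply: le_trans (ler_wpM2r _ p42) _.
  by rewrite ltW // divr_gt0 // mulr_gt0.
rewrite KE !natrM natrX le_eqVlt; apply/orP; left; apply/eqP; field.
by rewrite !gt_eqF ?exprn_gt0.
Qed.

Lemma volume_bound_gt0 : 0 < volume_bound.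
Proof.
have e20 : 0 < eps ^+ 2 by rewrite exprn_gt0.
rewrite /volume_bound ltr_wpDl //; last first.
  apply: mulr_gt0; first by rewrite ltr0n.
  by apply: ltr_wpDr => //; rewrite mulr_ge0 // divr_ge0 ?powR_ge0 // ltW.
have a0 := ltW alpha0; have e0 := ltW e20; have K0' := ltW K0.
by rewrite !addr_ge0 ?mulr_ge0 ?powR_ge0 ?invr_ge0.
Qed.

Lemma overflow_prob g past : (size past <= m)%N -> moment past <= guess g ->
  prob (fun w => ~ live g (ulog w g past)) <= 20^-1.
Proof.
move=> szm Mg; have V0 := volume_bound_gt0.
have c0 : 0 < 20 * volume_bound by rewrite mulr_gt0.
apply: le_trans (markov coin_rate01 (h := fun w => (volume g (ulog w g past))%:R) c0 _ _) _.
- by move=> w; rewrite ler0n.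
- move=> w /negP; rewrite -ltnNge => lt; apply: le_trans BV _.
  by rewrite ler_nat ltnW.
rewrite ler_pdivrMr // mulKf ?pnatr_eq0 //.
exact: expect_volume.
Qed.

(** In the exponent [L], 7 beats the factor 100, [r] the factor [2 ^ r], [b] the factor [n], and
    [3 * h] the number of times and two factors [h]. *)
Lemma missed_prob_small g past : (size past <= m)%N ->
  prob (missed^~ g ^~ past) <= (100 * h%:R)^-1.
Proof.
move=> szm; apply: le_trans (missed_prob g szm) _.
have hR : 0 < h%:R :> R by rewrite ltr0n.
rewrite LE -[leRHS]mul1r ler_pdivlMr ?mulr_gt0 //.
rewrite [leLHS](_ : _ = ((size past).+1 * (h * n) * 2 ^ r * (100 * h))%:R /
  (2 ^ (7 + r + b + 3 * h))%:R); last by rewrite !natrX !natrM !natrX; ring.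
rewrite ler_pdivrMr ?ltr0n ?expn_gt0 // mul1r ler_nat !expnD.
have hh : (h <= 2 ^ h)%N by rewrite ltnW // ltn_expl.
have sz : ((size past).+1 <= 2 ^ h)%N.
  apply: (@leq_trans (2 ^ h.-1 + 2 ^ h.-1)).
    by rewrite -addn1 leq_add // ?(leq_trans szm) // expn_gt0.
  by rewrite addnn -mul2n -expnS prednK.
have := leq_mul (leq_mul sz hh) (leq_mul hh nb).
rewrite expn0 muln1 (_ : (2 ^ 7)%N = 128%N) //.
move: (2 ^ r)%N (2 ^ h)%N (2 ^ b)%N => x y z le.
rewrite (_ : _ * _ = 100 * x * ((size past).+1 * h * (h * n)))%N; last by ring.
rewrite (_ : _ * (y * _) = 128 * x * (y * y * (y * z)))%N; last by ring.
by apply: leq_mul => //; rewrite leq_mul2r orbT.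
Qed.

(** The failures add up to at most [1/20] for the overflow of one good guess, and [2/100] for missed
    items and large errors over all guesses. *)
Lemma reliable_prob past : (0 < size past)%N -> (size past <= m)%N ->
  7%:R / 10%:R <= prob (reliable ^~ past).
Proof.
move=> s0 szm; have [g0 [Mg gM]] := exists_guess s0 szm.
have hR : 0 < h%:R :> R by rewrite ltr0n.
rewrite probC ?coin_rate01 //.
pose bad g w := guess g <= 2 `^ p * moment past /\
  (missed w g past \/ eps * moment past < `|error true w g past|).
have : prob (fun w => ~ reliable w past) <=
    prob (fun w => ~ live g0 (ulog w g0 past) \/ exists g, bad g w).
  apply: (prob_le coin_rate01) => w nr; apply: contrapT => /not_orP[/contrapT lv nb'].
  apply: nr; split; first by exists g0.
  move=> g gle; split; first by apply/negP => ms; apply: nb'; exists g; split; [|left].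
  by rewrite leNgt; apply/negP => lt; apply: nb'; exists g; split; [|right].
have p1' := prob_or coin_rate01 (fun w => ~ live g0 (ulog w g0 past))
  (fun w => exists g, bad g w).
have p2 := prob_exists coin_rate01 bad.
have p3 : \sum_g prob (bad g) <= 2 / 100.
  apply: (@le_trans _ _ (\sum_(g < h) (2 * (100 * h%:R)^-1))).
    apply: ler_sum => g _.
    case: (boolP (guess g <= 2 `^ p * moment past)) => gle; last first.
      apply: (@le_trans _ _ 0); last by rewrite mulr_ge0 // invr_ge0 mulr_ge0.
      rewrite -(expect_cst 'I_k coin_rate 0); apply: (le_expect coin_rate01) => w.
      by rewrite asboolF // => -[]; rewrite (negPf gle).
    apply: (@le_trans _ _ (prob (fun w => missed w g past \/
        eps * moment past < `|error true w g past|))).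
      by apply: (prob_le coin_rate01) => w [].
    apply: le_trans (prob_or coin_rate01 _ _) _; rewrite mulrDl mul1r lerD //.
      exact: missed_prob_small.
    exact: error_prob.
  rewrite sum_ord_cst le_eqVlt; apply/orP; left; apply/eqP; field.
  by rewrite gt_eqF.
have p4 := overflow_prob szm Mg.
lra.
Qed.

(** * From reliable coins to weak covers *)

Hypothesis alpha1 : alpha <= 1.

Local Notation total_power past := (fun j => (total past j)%:R `^ p : R).

(** The level is the integer part of the binary logarithm of the count; heaviness makes it allowed,
    and an item not missed is active there. *)
Lemma heavy_tracked w g past j : (size past <= m)%N ->
  guess g <= 2 `^ p * moment past -> ~~ missed w g past ->
  alpha * moment past < total_power past j -> tracked g (ulog w g past) j.
Proof.
move=> szm gle nm heavy; set v := total past j.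
have p0 : 0 < p by rewrite (lt_le_trans ltr01).
have v0 : (0 < v)%N.
  rewrite lt0n; apply/eqP => v0; move: heavy; rewrite -/v v0 powR0 ?p_neq0 //.
  by rewrite ltNge mulr_ge0 ?moment_ge0 // ltW.
have [vge vlt] : (2 ^ trunc_log 2 v <= v)%N /\ (v < 2 ^ (trunc_log 2 v).+1)%N.
  by rewrite trunc_logP // trunc_log_ltn.
have lh : (trunc_log 2 v < h)%N.
  rewrite -(prednK h0) ltnS -(@leq_exp2l 2) //; apply: leq_trans vge _.
  by rewrite (leq_trans (total_le_size _ _)) // (leq_trans szm).
pose l := Ordinal lh.
have al : allowed g l.
  apply: (@le_trans _ _ (2 `^ p * v%:R `^ p)).
    apply: le_trans (ler_wpM2l (ltW alpha0) gle) _.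
    by rewrite mulrCA ler_wpM2l ?powR_ge0 // ltW.
  rewrite -powRM //; apply: ge0_ler_powR;
    rewrite ?nnegrE ?mulr_ge0 ?(ltW p0) ?(ltW (pow2_gt0 l)) //.
  rewrite /pow2 -!natrM ler_nat /= (_ : 4 = 2 * 2)%N // -mulnA leq_mul2l /=.
  by rewrite -expnS ltnW.
apply/existsP; exists l; rewrite /active al /=; apply/orP; right; rewrite leqNgt.
have : ~~ missed_now w g past by case: (past) nm => [|? ?] /=; rewrite negb_or => /andP[].
by move=> /existsPn/(_ (l, j)) /=; rewrite al vge.
Qed.

Lemma reliable_cover w past (co : coord_memory n h) (u : 'I_n -> R) :
  (size past <= m)%N -> reliable w past ->
  (forall g, current j0 allowed thr co g = clog w g past) ->
  u =1 total_power past ->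
  weak_cover alpha eps u (output k j0 allowed thr B pw val_rate co).
Proof.
move=> szm [[g0 [Mg0 g0M lv0]] rel] cur uE.
have sumE : \sum_j u j = moment past by apply: eq_bigr => j _; rewrite uE.
have lvE g : live g (current j0 allowed thr co g) = live g (clog w g past) by rewrite cur.
have lv0' : live g0 (current j0 allowed thr co g0).
  by rewrite lvE clog_of_ulog_live.
rewrite /output /first_live; case: pickP => [g /andP[lvg /forallP mn]|no]; last first.
  case: (@arg_minnP _ g0 (fun g => live g (current j0 allowed thr co g))
    (fun g => g : nat) lv0') => g lvg mn.
  have := no g; rewrite lvg => /negP[]; apply/forallP => g'; apply/implyP; exact: mn.
(* The smallest live guess is at most the live guess [g0] that [reliable] provides. *)
have gle : guess g <= 2 `^ p * moment past.
  apply: le_trans g0M; apply: ge0_ler_powR; rewrite ?nnegrE ?ler0n //.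
    by rewrite (le_trans ler01).
  by rewrite ler_nat leq_exp2l //; have := mn g0; rewrite lv0'.
have curE : current j0 allowed thr co g = ulog w g past.
  by rewrite cur clog_of_live // -lvE.
rewrite curE; have [nm err] := rel g gle.
set tr := [seq j <- enum 'I_n | _].
set est := estimate g (ulog w g past).
have j0tr : tracked g (ulog w g past) j0.
  apply/existsP; exists g; rewrite /active !eqxx /= andbT /allowed.
  apply: (@le_trans _ _ (guess g)).
    by rewrite -[leRHS]mul1r ler_wpM2r // ltW // guess_gt0.
  have P0 := ltW (pow2_gt0 g).
  apply: ge0_ler_powR; rewrite ?nnegrE ?mulr_ge0 //; first exact: le_trans ler01 p1.
  by rewrite ler_peMl // ler1n.
have memQ j : tracked g (ulog w g past) j ->
    (j, est j) \in [fset (j, est j) | j in tr]%fset.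
  by move=> t; apply/imfsetP; exists j => //=; rewrite mem_filter t mem_enum.
split.
- by apply/fset0Pn; exists (j0, est j0); exact: memQ.
- move=> j heavy; exists (est j); apply: memQ; apply: heavy_tracked => //.
  by rewrite -uE -sumE.
rewrite big_imfset /=; last by move=> ? ? _ _ [].
have utr : uniq tr by rewrite filter_uniq // enum_uniq.
rewrite (undup_id utr) /tr big_filter big_enum_cond /=.
under eq_bigr do rewrite uE.
by rewrite sum_estimates -error_cut // sumE.
Qed.

(** A copy stops as soon as its volume exceeds [B], and the last step adds at most
    [h + k + k * h]. *)
Lemma volume_clog w g past :
  (volume g (clog w g past) <= B + (h + k + k * h))%N.
Proof.
elim: past => [|e past IH].
  rewrite /volume /reports /= add0n; apply: (@leq_trans k); last first.
    by rewrite addnA (leq_trans _ (leq_addr _ _)) // addnA leq_addl.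
  rewrite -[leqRHS]muln1 leq_mul2l; apply/orP; right.
  rewrite -(cards1 (g, j0)); apply: subset_leq_card; apply/subsetP => -[l j].
  rewrite !inE /active /= => /andP[_ /orP[/andP[/eqP-> /eqP->]//|]].
  by rewrite /thr; case: (low l) => //; rewrite leqNgt r_gt0.
rewrite /clog /= -/(clog w g past); case: ifP => // lv.
by apply: leq_trans; [exact: volume_extend_le|rewrite leq_add2r].
Qed.

(** * Correctness and worst-case cost of the protocol *)

Section Tracking.
Variables (wd : nat) (enc : msg n m h -> bits) (dec : bits -> option (msg n m h)).
Hypotheses (encK : pcancel enc dec) (size_enc : forall x, size (enc x) = wd).

Definition tracker : protocol R k n :=
  cover_protocol k j0 ripe allowed thr B pw val_rate enc dec coin_rate01.

Lemma Pr_tracker (E : coins -> Prop) : Pr (P := tracker) (fun s => E s.1) = prob E.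
Proof.
rewrite probE /Pr big_mkcond /=.
rewrite -(pair_big xpredT xpredT (fun (w : coins) (x : unit) =>
  if `[< E w >] then seeds_pmf (P := tracker) (w, x) else 0)) /=.
apply: eq_bigr => w _; rewrite (big_pred1 tt) => [|[]//].
by case: asboolP => _; rewrite ?mulr0 // /seeds_pmf /= !mulr1.
Qed.

Lemma tracker_correct : tracks_weak_cover tracker p alpha eps m.
Proof.
move=> st t /andP[t0 tm].
have szt : size (take t st) = t by rewrite size_take_min size_tuple; exact/minn_idPl.
apply: (le_trans (@reliable_prob (rev (take t st)) _ _)); rewrite ?size_rev ?szt //.
rewrite -Pr_tracker /Pr big_mkcond [leRHS]big_mkcond.
apply: ler_sum => s _; case: asboolP => [rel|_]; last first.
  by case: ifP => // _; rewrite /seeds_pmf /= mulr1 (coins_weight_ge0 coin_rate01 s.1).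
rewrite asboolT //.
have [|c run [_ _ cur _]] := run_simulates encK size_enc s (st := take t st) k0.
  by rewrite szt.
exists c => //; apply: (reliable_cover _ rel cur); first by rewrite size_rev szt.
move=> j; rewrite /power_vector /item_count /site_count /total count_rev; congr (_%:R `^ _).
rewrite -[RHS]/(total (take t st) j) -sum_site_counts.
apply: eq_bigr => i _; rewrite count_map count_filter.
by apply: eq_count => -[i' j'] /=; rewrite xpair_eqE andbC.
Qed.

Lemma tracker_cost : total_cost_le tracker m
  (wd.+1 * (3 * (h * (B + (h + k + k * h))) + 2 * k * h))%:R.
Proof.
move=> st s; have [|c run [_ _ _ cst]] := run_simulates encK size_enc s (st := st) k0.
  by rewrite size_tuple.
exists c => //; rewrite ler_nat; apply: leq_trans cst _.
rewrite leq_mul2l /= leq_add //.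
  rewrite leq_mul2l /= -[X in (X * _)%N](card_ord h) -sum_nat_const.
  by apply: leq_sum => g _; exact: volume_clog.
by rewrite leq_mul2l -[X in (_ <= X)%N](card_ord h) max_card orbT.
Qed.

End Tracking.
End Analysis.

(** * The total cost *)

Section CostBound.
Variables (R : realType) (p alpha eps : R) (r k : nat).
Hypotheses (p2 : 2 <= p) (pr : p <= r%:R) (alpha0 : 0 < alpha) (alpha1 : alpha <= 1)
  (eps0 : 0 < eps) (k0 : (0 < k)%N).

Let X : R := k%:R `^ (p - 1) / alpha.
Let Y : R := k%:R / eps ^+ 2.

Let X0 : 0 <= X. Proof. by rewrite divr_ge0 ?powR_ge0 // ltW. Qed.
Let Y0 : 0 <= Y. Proof. by rewrite divr_ge0 // exprn_ge0 // ltW. Qed.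

(** Polls at activations cost [k / alpha]; [2 <= p] gives [k <= k ^ (p - 1)]. *)
Lemma k_div_alpha_le : k%:R / alpha <= X.
Proof.
rewrite ler_wpM2r ?invr_ge0 ?(ltW alpha0) // le1r_powR ?ler1n //.
by move: (p2); lra.
Qed.

Lemma k_le_cost : k%:R <= X.
Proof. by apply: le_trans k_div_alpha_le; rewrite ler_pdivlMr // ler_piMr. Qed.

(** Here [b] stands for a logarithm of [n], and [H0], [L0], [K0] for constants. Real powers of
    multiples of [L] are bounded by their [r]-th powers, which leaves a monomial in [b]. *)
Lemma volume_bound_le (h L : nat) (K b H0 L0 K0 : R) :
  1 <= b -> (0 < L)%N -> 0 <= K -> 0 <= H0 -> 0 <= L0 -> 0 <= K0 ->
  h%:R <= H0 * b -> L%:R <= L0 * b -> K <= K0 * b ->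
  volume_bound p alpha eps K k h L <=
  (H0 * (4 * L0) * (2 `^ (p - 1) * 4 `^ p) + H0 * K0 * (4 * L0) ^+ r + K0 + 1
    + H0 * (16 * L0) ^+ r) * b ^+ (r + 2) * (X + Y).
Proof.
move=> b1 Lpos Kge H0p L0p K0p hle Lle Kle.
have b0 : 0 <= b by rewrite (le_trans ler01).
have e20 : 0 < eps ^+ 2 by rewrite exprn_gt0.
have pw (s : R) (c : nat) : (0 < c)%N -> s <= r%:R ->
    (c * L)%:R `^ s <= (c%:R * L0) ^+ r * b ^+ r.
  move=> c0 sr; rewrite -exprMn; apply: (@le_trans _ _ ((c * L)%:R ^+ r)).
    by rewrite -powR_mulrn // ler_powR // ler1n muln_gt0 c0.
  rewrite lerXn2r ?nnegrE ?mulr_ge0 // natrM -mulrA; exact: ler_wpM2l.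
have bmono i j : (i <= j)%N -> b ^+ i <= b ^+ j by move=> ij; exact: ler_weXn2l.
have pr1 : p - 1 <= r%:R by rewrite (le_trans _ pr) // gerBl.
have t1 : h%:R * ((4 * L)%:R * (2 * k)%:R `^ (p - 1) * (4 `^ p / alpha)) <=
    H0 * (4 * L0) * (2 `^ (p - 1) * 4 `^ p) * b ^+ (r + 2) * X.
  rewrite natrM [(2 * k)%:R]natrM powRM //.
  have -> : h%:R * (4 * L%:R * (2 `^ (p - 1) * k%:R `^ (p - 1)) * (4 `^ p / alpha)) =
      h%:R * (4 * L%:R) * (2 `^ (p - 1) * 4 `^ p) * X by rewrite /X; ring.
  apply: ler_wpM2r => //.
  apply: (@le_trans _ _ ((H0 * b) * (4 * (L0 * b)) * (2 `^ (p - 1) * 4 `^ p))).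
    apply: ler_wpM2r; first by rewrite mulr_ge0 ?powR_ge0.
    by apply: ler_pM => //; rewrite ?mulr_ge0 // ler_wpM2l.
  have -> : H0 * b * (4 * (L0 * b)) * (2 `^ (p - 1) * 4 `^ p) =
    H0 * (4 * L0) * (2 `^ (p - 1) * 4 `^ p) * b ^+ 2 by ring.
  by apply: ler_wpM2l; [rewrite !mulr_ge0 ?powR_ge0|apply: bmono; rewrite leq_addl].
have t2 : k%:R * (h%:R * (K * (4 * L)%:R `^ (p - 1) / eps ^+ 2)) <=
    H0 * K0 * (4 * L0) ^+ r * b ^+ (r + 2) * Y.
  have -> : k%:R * (h%:R * (K * (4 * L)%:R `^ (p - 1) / eps ^+ 2)) =
    h%:R * K * (4 * L)%:R `^ (p - 1) * Y by rewrite /Y; ring.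
  apply: ler_wpM2r => //.
  have -> : H0 * K0 * (4 * L0) ^+ r * b ^+ (r + 2) =
    (H0 * b) * (K0 * b) * ((4 * L0) ^+ r * b ^+ r) by rewrite exprD; ring.
  by apply: ler_pM; rewrite ?mulr_ge0 ?powR_ge0 //; [exact: ler_pM|exact: pw].
have t3 : k%:R * (K / eps ^+ 2) <= K0 * b ^+ (r + 2) * Y.
  have -> : k%:R * (K / eps ^+ 2) = K * Y by rewrite /Y; ring.
  apply: ler_wpM2r => //; apply: le_trans Kle _; apply: ler_wpM2l => //.
  by rewrite -[leLHS]expr1 bmono // addn2.
have t4 : k%:R * (1 + h%:R * ((16 * L)%:R `^ p / alpha)) <=
    (1 + H0 * (16 * L0) ^+ r) * b ^+ (r + 2) * X.
  have -> : k%:R * (1 + h%:R * ((16 * L)%:R `^ p / alpha)) =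
     k%:R + h%:R * (16 * L)%:R `^ p * (k%:R / alpha) by ring.
  have -> : (1 + H0 * (16 * L0) ^+ r) * b ^+ (r + 2) * X =
    b ^+ (r + 2) * X + H0 * (16 * L0) ^+ r * b ^+ (r + 2) * X by ring.
  apply: lerD.
    rewrite -[leLHS]mul1r; apply: ler_pM; rewrite ?k_le_cost //.
    by rewrite exprn_ege1.
  apply: ler_pM; rewrite ?mulr_ge0 ?powR_ge0 ?invr_ge0 ?(ltW alpha0) ?k_div_alpha_le //.
  apply: (@le_trans _ _ ((H0 * b) * ((16 * L0) ^+ r * b ^+ r))).
    by apply: ler_pM; rewrite ?powR_ge0 //; exact: pw.
  have -> : H0 * b * ((16 * L0) ^+ r * b ^+ r) = H0 * (16 * L0) ^+ r * b ^+ (r + 1).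
    by rewrite exprD; ring.
  apply: ler_wpM2l; first by rewrite mulr_ge0 // exprn_ge0 // mulr_ge0.
  by rewrite bmono // leq_add2l.
rewrite /volume_bound; apply: le_trans (lerD (lerD (lerD t1 t2) t3) t4) _.
have B0 : 0 <= b ^+ (r + 2) by rewrite exprn_ge0.
have c1 : 0 <= H0 * (4 * L0) * (2 `^ (p - 1) * 4 `^ p) by rewrite !mulr_ge0 ?powR_ge0.
have c2 : 0 <= H0 * K0 * (4 * L0) ^+ r by rewrite !mulr_ge0 // exprn_ge0 // mulr_ge0.
have c4 : 0 <= H0 * (16 * L0) ^+ r by rewrite mulr_ge0 // exprn_ge0 // mulr_ge0.
move: c1 c2 c4; set x1 := H0 * (4 * L0) * _; set x2 := H0 * K0 * _; set x4 := H0 * _.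
move=> c1 c2 c4; rewrite -subr_ge0.
have -> : (x1 + x2 + K0 + 1 + x4) * b ^+ (r + 2) * (X + Y) -
   (x1 * b ^+ (r + 2) * X + x2 * b ^+ (r + 2) * Y + K0 * b ^+ (r + 2) * Y +
   (1 + x4) * b ^+ (r + 2) * X) =
   b ^+ (r + 2) * ((x1 + 1 + x4) * Y + (x2 + K0) * X) by ring.
by rewrite mulr_ge0 // addr_ge0 // mulr_ge0 // !addr_ge0.
Qed.

End CostBound.

(** * Message length and logarithmic factors *)

Lemma card_msg (n m h b : nat) : (0 < h)%N -> (n <= 2 ^ b)%N -> (m <= 2 ^ h.-1)%N ->
  (#|{: msg n m h}| <= 2 ^ (b + h * h + h + 2))%N.
Proof.
move=> h0 nb mh.
have cset : #|{: {set 'I_h}}| = (2 ^ h)%N.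
  by rewrite -cardsT -powersetT card_powerset cardsT card_ord.
rewrite card_sum card_sum !card_prod !card_ffun card_option cset !card_ord.
have hh : (h.+1 <= 2 ^ h)%N by exact: ltn_expl.
have mh' : (m.+1 <= 2 ^ h)%N.
  apply: (@leq_trans (2 ^ h.-1 + 2 ^ h.-1)).
    by rewrite -addn1 leq_add // expn_gt0.
  by rewrite addnn -mul2n -expnS prednK.
have c1 : (n * (2 ^ h) ^ h * 2 ^ h <= 2 ^ (b + h * h + h))%N.
  by rewrite -expnM !expnD !leq_mul.
have c2 : (n * h.+1 ^ h * 2 ^ h <= 2 ^ (b + h * h + h))%N.
  by rewrite !expnD [(2 ^ (h * h))%N]expnM !leq_mul // leq_exp2r.
have c3 : (m.+1 <= 2 ^ (b + h * h + h))%N.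
  by apply: leq_trans mh' _; rewrite leq_exp2l // leq_addl.
rewrite expnD (_ : 2 ^ 2 = 4)%N //; lia.
Qed.

(** [2 ^ (up_log 2 n).+1 <= 4 * n.+1 <= n.+1 ^ 3], as [2 <= n.+1]. The successor keeps the logarithm
    positive at [n = 1]. *)
Lemma up_log_le_ln (R : realType) (n : nat) : (0 < n)%N ->
  (up_log 2 n).+1%:R <= 3 / ln 2 * ln n.+1%:R :> R.
Proof.
move=> n0; have l2 : 0 < ln 2 :> R by rewrite ln_gt0 // ltr1n.
have up : (2 ^ (up_log 2 n).+1 <= 4 * n.+1)%N.
  have [n1|n1] := leqP n 1.
    by have -> : n = 1%N by lia.
  have /andP[lt _] := up_log_bounds (isT : 1 < 2)%N n1.
  have u0 : (0 < up_log 2 n)%N by rewrite up_log_gt0.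
  by move: lt; rewrite -{2}(prednK u0) !expnS; lia.
have nn : 0 < n.+1%:R :> R by rewrite ltr0n.
rewrite mulrAC ler_pdivlMr // mulr_natl -lnXn //.
apply: (@le_trans _ _ (ln (4 * n.+1%:R))).
  by rewrite ler_ln ?posrE ?exprn_gt0 ?mulr_gt0 // -natrX -natrM ler_nat.
rewrite lnM ?posrE // (_ : 4 = 2 ^+ 2); last by rewrite -natrX.
rewrite lnXn //; have : ln 2 <= ln n.+1%:R :> R by rewrite ler_ln ?posrE ?ler_nat.
by rewrite mulr2n; lra.
Qed.

Lemma total_cost_le_trans (R : realType) k n (P : protocol R k n) m (B1 B2 : R) :
  total_cost_le P m B1 -> B1 <= B2 -> total_cost_le P m B2.
Proof.
move=> H le st s; have [c run cst] := H st s.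
by exists c => //; exact: le_trans le.
Qed.

Lemma message_total_le (R : realType) (e : nat) (W0 H0 V0 b S h k w B : R) :
  1 <= b -> 1 <= S -> 0 <= W0 -> 0 <= H0 -> 0 <= V0 -> 0 <= h -> 0 <= k -> 0 <= B ->
  h <= H0 * b -> k <= S -> 1 <= k -> w <= W0 * b ^+ 2 ->
  B <= 20 * (V0 * b ^+ e.+1 * S) + 1 ->
  w * (3 * (h * (B + (h + k + k * h))) + 2 * k * h) <=
  W0 * (3 * H0 * (20 * V0 + 2 + 2 * H0) + 2 * H0) * b ^+ (e + 4) * S.
Proof.
move=> b1 S1 W00 H00 V00 h0 k0 B0 hle kle k1 wle Ble.
have b0 : 0 <= b by rewrite (le_trans ler01).
have S0 : 0 <= S by rewrite (le_trans ler01).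
have be1 : b <= b ^+ e.+1 by rewrite -[leLHS]expr1 ler_weXn2l.
have be : 1 <= b ^+ e.+1 by rewrite exprn_ege1.
have khle : k * h <= H0 * b * S by rewrite mulrC ler_pM.
have hle' : h <= H0 * b * S.
  by apply: le_trans khle; rewrite ler_peMl.
have T0 : 0 <= H0 * S by rewrite mulr_ge0.
have HbS : H0 * b * S <= H0 * b ^+ e.+1 * S by rewrite ler_wpM2r // ler_wpM2l.
have bS : S <= b ^+ e.+1 * S by rewrite ler_peMl.
have bS2 : b * S <= b ^+ e.+2 * S.
  by apply: ler_wpM2r => //; rewrite -[leLHS]expr1; apply: ler_weXn2l.
have in1 : B + (h + k + k * h) <= (20 * V0 + 2 + 2 * H0) * (b ^+ e.+1 * S).
  have -> : (20 * V0 + 2 + 2 * H0) * (b ^+ e.+1 * S) = 20 * (V0 * b ^+ e.+1 * S) +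
    (b ^+ e.+1 * S) + (b ^+ e.+1 * S) + H0 * b ^+ e.+1 * S + H0 * b ^+ e.+1 * S by ring.
  move: (V0 * _ * S) Ble (b ^+ e.+1 * S) bS (H0 * b ^+ e.+1 * S) HbS => x Ble y bS z HbS.
  move: (H0 * b * S) hle' khle HbS => t hle' khle HbS.
  move: (k * h) khle => kh khle; lra.
have in2 : 3 * (h * (B + (h + k + k * h))) + 2 * k * h <=
    (3 * H0 * (20 * V0 + 2 + 2 * H0) + 2 * H0) * (b ^+ e.+2 * S).
  rewrite [leRHS]mulrDl; apply: lerD.
    have -> : 3 * H0 * (20 * V0 + 2 + 2 * H0) * (b ^+ e.+2 * S) =
      3 * ((H0 * b) * ((20 * V0 + 2 + 2 * H0) * (b ^+ e.+1 * S))).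
      by rewrite [b ^+ e.+2]exprS; ring.
    rewrite ler_wpM2l //.
    by apply: ler_pM => //; rewrite !addr_ge0 // mulr_ge0.
  rewrite -[2 * k * h]mulrA -[2 * H0 * _]mulrA; apply: ler_wpM2l => //.
  apply: le_trans khle _; rewrite -[H0 * b * S]mulrA.
  by apply: ler_wpM2l => //; exact: bS2.
apply: le_trans (ler_wpM2r _ wle) _.
  by rewrite addr_ge0 // !mulr_ge0 // !addr_ge0 // mulr_ge0.
have -> : W0 * (3 * H0 * (20 * V0 + 2 + 2 * H0) + 2 * H0) * b ^+ (e + 4) * S =
  (W0 * b ^+ 2) * ((3 * H0 * (20 * V0 + 2 + 2 * H0) + 2 * H0) * (b ^+ e.+2 * S)).
  have -> : b ^+ (e + 4) = b ^+ 2 * b ^+ e.+2.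
    by rewrite -exprD; congr (b ^+ _); rewrite !addnS addn0.
  by move: (b ^+ 2) (b ^+ e.+2) => x y; ring.
by apply: ler_wpM2l => //; rewrite mulr_ge0 // exprn_ge0.
Qed.

Unset Implicit Arguments.

Theorem theorem8 (R : realType) (p : R) (hp : 2%:R <= p) (A a : nat) :
  exists (C : R) (c : nat),
  forall (k n m : nat) (alpha eps : R),
    (0 < k)%N -> (0 < n)%N -> (m <= A * n ^ a)%N ->
    0 < alpha < 1 -> 0 < eps < 1 ->
    exists P : protocol R k n,
      tracks_weak_cover P p alpha eps m /\
      total_cost_le P m
        (C * ((k%:R `^ (p - 1) / alpha + k%:R / eps ^+ 2)
              * ln (n.+1)%:R ^+ c)).
Proof.
pose r := (Num.truncn p).+1.
have p0 : 0 <= p by rewrite (le_trans _ hp).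
have p1 : 1 <= p by rewrite (le_trans _ hp) // ler1n.
have pr : p <= r%:R by have /andP[_ /ltW] := Num.Theory.truncn_itv p0.
(* These constants depend only on [p], [A] and [a]; they bound [h], [L] and [K] relative to [be],
   the logarithm of [n] plus 1. *)
pose h0 := (up_log 2 A + a + 1)%N.
pose l0 := (8 + r + 3 * h0)%N.
pose q0 := (100 * r * 4 ^ r * h0)%N.
pose H0 : R := h0%:R; pose L0 : R := l0%:R; pose K0 : R := q0%:R.
pose V0 : R := H0 * (4 * L0) * (2 `^ (p - 1) * 4 `^ p) + H0 * K0 * (4 * L0) ^+ r
  + K0 + 1 + H0 * (16 * L0) ^+ r.
pose W0 : R := (h0 * h0 + h0 + 4)%:R.
have V00 : 0 <= V0.
  by rewrite !addr_ge0 ?mulr_ge0 ?powR_ge0 ?exprn_ge0 ?mulr_ge0 ?ler0n.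
pose C0 := W0 * (3 * H0 * (20 * V0 + 2 + 2 * H0) + 2 * H0).
have C00 : 0 <= C0.
  by rewrite mulr_ge0 ?ler0n // addr_ge0 ?mulr_ge0 ?addr_ge0 ?mulr_ge0 ?ler0n.
(* The exponent is [r + 2] for the volume bound, 1 for the number of guesses, and 2 for the message
   length. *)
exists (C0 * (3 / ln 2) ^+ (r + 1 + 4)), (r + 1 + 4)%N.
move=> k n m alpha eps kpos npos mle /andP[al0 al1] /andP[ep0 ep1].
pose b := up_log 2 n; pose be := b.+1.
have nb : (n <= 2 ^ b)%N by exact: up_logP.
(* Chosen so that [2 ^ h.-1] is at least [A * n ^ a], hence at least [m]. *)
pose h := (up_log 2 A + a * b).+1.
have mh : (m <= 2 ^ h.-1)%N.
  apply: leq_trans mle _; rewrite expnD leq_mul ?up_logP //.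
  by rewrite mulnC expnM; case: (a) => // a'; rewrite leq_exp2r.
pose L := (7 + r + b + 3 * h)%N.
pose Kn := (100 * r * 4 ^ r * h)%N.
have Kpos : 0 < Kn%:R :> R by rewrite ltr0n !muln_gt0 expn_gt0.
have hle : (h <= h0 * be)%N.
  rewrite /h /h0 !mulnDl mul1n -addn1.
  by rewrite leq_add // leq_add ?leq_pmulr // leq_mul.
have Lle : (L <= l0 * be)%N.
  rewrite (_ : l0 * be = 8 * be + r * be + 3 * (h0 * be))%N; last by rewrite /l0; ring.
  apply: leq_add; last by rewrite leq_mul2l.
  by rewrite addnAC leq_add ?leq_pmulr // /be mulnS leq_add // leq_pmull.
have Kle : (Kn <= q0 * be)%N by rewrite /Kn /q0 -[(_ * h0 * be)%N]mulnA leq_mul.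
pose S := k%:R `^ (p - 1) / alpha + k%:R / eps ^+ 2.
have be1 : 1 <= be%:R :> R by rewrite ler1n.
have VB : volume_bound p alpha eps Kn%:R k h L <= V0 * be%:R ^+ (r + 2) * S.
  apply: volume_bound_le => //; rewrite ?ler0n -?natrM ?ler_nat //.
  exact: ltW.
have k1 : 1 <= k%:R :> R by rewrite ler1n.
have kS : k%:R <= S.
  apply: (le_trans (k_le_cost hp al0 (ltW al1) kpos)).
  by rewrite lerDl divr_ge0 // exprn_ge0 // ltW.
pose vb := volume_bound p alpha eps Kn%:R k h L.
have vb0 : 0 <= 20 * vb.
  by rewrite mulr_ge0 // ltW // volume_bound_gt0.
pose B := (Num.truncn (20 * vb)).+1.
have [Blo Bhi] : 20 * vb <= B%:R /\ B%:R <= 20 * vb + 1.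
  have /andP[lo hi] := Num.Theory.truncn_itv vb0.
  by split; [exact: ltW|rewrite -[B%:R]natr1 lerD2r].
pose wd := (b + h * h + h + 2)%N.
have [enc [dec [encK size_enc]]] :=
  exists_code (card_msg (m := m) (isT : 0 < h)%N nb mh).
exists (tracker p alpha r k L (Ordinal npos) ep0 Kpos B enc dec); split.
  have Lpos : (0 < L)%N by [].
  have hpos : (0 < h)%N by [].
  exact: (tracker_correct (Ordinal npos) p1 pr al0 ep0 Kpos kpos Lpos mh hpos nb
    erefl erefl Blo (ltW al1) encK size_enc).
apply: total_cost_le_trans (tracker_cost p1 pr kpos encK size_enc) _.
rewrite natrM natrD !natrM !natrD !natrM.
have Wle : wd.+1%:R <= W0 * be%:R ^+ 2 :> R.
  rewrite -natrX -natrM ler_nat /wd expnS expn1.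
  have hh : (h * h <= h0 * h0 * (be * be))%N by rewrite mulnACA leq_mul.
  have hb : (h <= h0 * (be * be))%N.
    by apply: leq_trans hle _; rewrite leq_mul2l leq_pmulr ?orbT.
  have bb : (b + 3 <= 4 * (be * be))%N.
    apply: (@leq_trans (4 * be)); last by rewrite leq_mul2l leq_pmulr.
    by rewrite /be mulnS addnC leq_add // leq_pmull.
  rewrite [leqRHS](_ : _ = h0 * h0 * (be * be) + h0 * (be * be) + 4 * (be * be))%N.
    rewrite (_ : _.+1 = h * h + h + (b + 3))%N; last by rewrite -addn1; ring.
    exact: leq_add (leq_add hh hb) bb.
  by ring.
apply: le_trans (message_total_le (e := r.+1) (H0 := H0) (V0 := V0) be1 (le_trans k1 kS)
  _ _ V00 (ler0n _ h) (ler0n _ k) (ler0n _ B) _ kS k1 Wle _) _; rewrite ?ler0n //.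
- by rewrite -natrM ler_nat.
- apply: le_trans Bhi _; rewrite lerD2r ler_wpM2l //.
  by rewrite -addn2.
rewrite -/C0 addn1 [leRHS](_ : _ = C0 * ((3 / ln 2) ^+ (r.+1 + 4) *
  ln n.+1%:R ^+ (r.+1 + 4)) * S); last by rewrite -/S [S * _]mulrC !mulrA.
have S0 : 0 <= S by exact: le_trans ler01 (le_trans k1 kS).
rewrite ler_wpM2r // ler_wpM2l // -exprMn lerXn2r ?nnegrE ?ler0n //;
  last exact: up_log_le_ln.
by apply: le_trans (up_log_le_ln R npos); rewrite ler0n.
Qed.
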